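(* Let $\gamma:\mathcal T\to\mathbb R$ be sublinear and continuous, where $\mathcal T\subseteq L_2^0(P)$ is a linear subspace (the tangent space). Let $\Lambda_P:=\{\lambda\in\overline{\mathcal T}:\langle\lambda,h\rangle\le\gamma(h)\ \forall h\in\mathcal T\}$ and $F_P:=\overline{\operatorname{span}}(\Lambda_P-\Lambda_P)$. Assumption 1 (see context) is in force in (4), (5) and where indicated in (3). (1) $\Lambda_P$ is nonempty, convex, closed and bounded, and $\gamma(h)=\max_{\lambda\in\Lambda_P}\langle\lambda,h\rangle$ for all $h\in\mathcal T$. (2) $N(\gamma)=\mathcal H_\kappa=\mathcal A(\gamma)=F_P^\perp\cap\mathcal T$ (the lineality space of $\gamma$), and $\mathcal L_{\max}(\gamma)=\{\mathcal H_\kappa\}$. (3) $\gamma(h)=\langle\lambda,h\rangle$ for all $h\in\mathcal H_\kappa$, $\lambda\in\Lambda_P$; and $\tilde\psi_\kappa:=\tilde\psi_{\mathcal H_\kappa}=\Pi_{\mathcal H_\kappa}\lambda$ for every $\lambda\in\Lambda_P$. Under Assumption 1, $\mathcal T=\mathcal H_\kappa\oplus F_P$, $\tilde\psi_\kappa$ is the minimum-norm element of $\overline{\operatorname{aff}}\,\Lambda_P=\lambda+F_P$ (any $\lambda\in\Lambda_P$), characterized as the unique element of this closed affine hull orthogonal to $F_P$, and $V_\kappa=V^\star=\operatorname{dist}(0,\overline{\operatorname{aff}}\,\Lambda_P)^2$. (4) $V_\kappa\le\|\lambda\|^2$ for all $\lambda\in\Lambda_P$, with equality if and only if $\lambda\perp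 F_P$. (5) If $\Lambda_P=\operatorname{conv}\{\lambda_1,\dots,\lambda_K\}$ with $\lambda_a\in\mathcal T$ and Gram matrix $\Sigma=(\langle\lambda_a,\lambda_b\rangle)_{a,b}\succeq0$, then $V_\kappa=\min\{w^\top\Sigma w:\mathbf 1^\top w=1\}$, which equals $1/(\mathbf 1^\top\Sigma^+\mathbf 1)$ if $\mathbf 1\in\operatorname{range}(\Sigma)$ and $0$ otherwise (equivalently $V_\kappa=0$ if and only if $0\in\overline{\operatorname{aff}}\,\Lambda_P$); in the first case $\tilde\psi_\kappa=\sum_aw^*_a\lambda_a$ with $w^*=\Sigma^+\mathbf 1/(\mathbf 1^\top\Sigma^+\mathbf 1)$; and $\operatorname{codim}_{\mathcal T}\mathcal H_\kappa=\operatorname{rank}(\lambda_a-\lambda_1)_{a\ge2}\le K-1$.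
   Context: $P$ is a fixed element of a set $\mathcal P$ of probability measures; $L_2^0(P)$ is the Hilbert space of mean-zero functions in $L_2(P)$ with inner product $\langle\cdot,\cdot\rangle$; overlines denote closures there. A DQM path with score $h$ is a map $t\mapsto P_t\in\mathcal P$, $t\in[0,\varepsilon)$, $P_0=P$, with $\int[(dP_t^{1/2}-dP^{1/2})/t-\tfrac12h\,dP^{1/2}]^2\to0$ as $t\downarrow0$. Assumption 1: $\mathcal T$ is closed in $L_2(P)$ and every $h\in\mathcal T$ is the score of some DQM path in $\mathcal P$. Sublinear means positively homogeneous ($\gamma(ch)=c\gamma(h)$, $c\ge0$) and subadditive. $N(\gamma):=\{h\in\mathcal T:\gamma(h)+\gamma(-h)=0\}$. A linearity subspace is a linear subspace $V\subseteq\mathcal T$ with $\gamma|_V$ linear; $\mathcal L(\gamma)$ is the family of these and $\mathcal L_{\max}(\gamma)$ its maximal elements under inclusion. The core is $\mathcal H_\kappa:=\{w\in N(\gamma):\gamma(v+cw)=\gamma(v)+c\gamma(w)\ \forall v\in N(\gamma),c\in\mathbb R\}$; the additivity space is $\mathcal A(\gamma):=\{w\in\mathcal T:\gamma(h+w)=\gamma(h)+\gamma(w)\ \forall h\in\mathcal T\}$. For $V\in\mathcal L(\gamma)$, $\tilde\psi_V\in\overline V$ is the Riesz representer of (the continuous extension to $\overline V$ of) $\gamma|_V$ and $V_V:=\|\tilde\psi_V\|^2$. $V_\kappa:=V_{\mathcal H_\kappa}$ and $V^\star:=\sup_{V\in\mathcal L(\gamma)}V_V$. $\Pi_{\mathcal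 H_\kappa}$ is orthogonal projection onto (the closure of) $\mathcal H_\kappa$; $\overline{\operatorname{aff}}$ is the closed affine hull; $\Sigma^+$ is the Moore–Penrose inverse; $\mathbf 1$ is the vector of ones. *)

(* Defs.v *)
From HB Require Import structures.
From mathcomp Require Import all_boot all_order all_algebra.
From mathcomp Require Import all_classical all_reals all_analysis.
From mathcomp Require Import measurable_realfun ess_sup_inf.
Set Implicit Arguments.
Unset Strict Implicit.
Unset Printing Implicit Defensive.
Import Order.TTheory GRing.Theory Num.Theory.
Import numFieldNormedType.Exports.
Local Open Scope classical_set_scope.
Local Open Scope ring_scope.
Local Open Scope charge_scope.

(* The library leaves the quotient type LspaceType mu p1 without algebraic
   structure. It is equipped here with the normedModType structure induced by
   pointwise operations on representatives and the norm 'N[mu]_p; for p = 2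
   this yields L_2(P) with its norm topology and almost-everywhere equality as
   Leibniz equality. *)
Section LspaceType_normedModType.
Context {d} {T : measurableType d} {R : realType}.
Variables (mu : {measure set T -> \bar R}) (p : \bar R) (p1 : (1 <= p)%E).
Notation Lspc := (LspaceType mu p1).
Notation Lfct := (LfunType mu p1).

Lemma ae_eq_Lnorm (f g : T -> R) :
  measurable_fun setT f -> measurable_fun setT g ->
  f = g %[ae mu] -> 'N[mu]_p[EFin \o f]%E = 'N[mu]_p[EFin \o g]%E.
Proof.
move=> mf mg fg; rewrite unlock.
case: p p1 => [r r1| _|//].
- have mr (h : T -> R) : measurable_fun setT h ->
      measurable_fun setT (fun x => `|(EFin \o h) x| `^ r)%E.
    move=> mh; apply/measurable_EFinP.
    apply: (@measurableT_comp _ _ _ _ _ _ (@powR R ^~ r)) => //.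
    exact: measurableT_comp.
  congr (_ `^ _)%E; apply: ae_eq_integral => //; [exact: mr|exact: mr|].
  by apply: filterS fg => x /= + Dx => ->.
- case: ifPn => // _; apply: eq_ess_sup.
  by apply: filterS fg => x /= ->.
Qed.

Definition Lspace_repr (f : Lspc) : {mfun T >-> measurableTypeR R} :=
  repr (f : {mfun_ mu, T >-> measurableTypeR R}).

Lemma Lspace_repr_Lfun (f : Lspc) : (Lspace_repr f : T -> R) \in Lfun mu p.
Proof.
rewrite inE; apply/andP; split; rewrite inE/=; first exact: (@measurable_funPT _ _ _ _ (Lspace_repr f)).
exact: (@Lebesgue_finite _ _ _ _ _ _ f).
Qed.

Definition Lfun_of_Lspace (f : Lspc) : Lfct := Lfun_Sub p1 (Lspace_repr_Lfun f).

Let mfun_of (f : Lfct) : {mfun T >-> measurableTypeR R} :=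
  @mfun_Sub _ _ T (measurableTypeR R) f (sub_Lfun_mfun (LfunP f)).

Let pi_Lfun (f : Lfct) : {mfun_ mu, T >-> measurableTypeR R} :=
  (\pi_({mfun_ mu, T >-> measurableTypeR R}) (mfun_of f))%qT.

Let repr_pi_Lfun (f : Lfct) :
  (repr (pi_Lfun f) : T -> R) = (f : T -> R) %[ae mu].
Proof.
have /eqmodP/asboolP := reprK (pi_Lfun f).
by [].
Qed.


Let finite_norm_pi_Lfun (f : Lfct) : finite_norm mu p (pi_Lfun f).
Proof.
rewrite /finite_norm (@ae_eq_Lnorm _ f)//; last exact: repr_pi_Lfun.
  exact: Lfunction_finite.
exact: (@measurable_funPT _ _ _ _ (repr (pi_Lfun f))).
Qed.

Definition Lspace_of_Lfun (f : Lfct) : Lspc :=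
  HB.pack_for Lspc (pi_Lfun f)
    (isFinLebesgue.Build _ _ _ _ _ p1 _ (finite_norm_pi_Lfun f)).

Let Lspace_inj (f g : Lspc) :
  f = g :> {mfun_ mu, T >-> measurableTypeR R} -> f = g.
Proof.
case: f g => f [[hf]] [g [[hg]]] /= fg; rewrite {}fg in hf *.
by rewrite (Prop_irrelevance hf hg).
Qed.

Lemma Lspace_of_LfunP (f g : Lfct) :
  Lspace_of_Lfun f = Lspace_of_Lfun g <-> (f : T -> R) = (g : T -> R) %[ae mu].
Proof.
split => [fg|fg]; last by apply: Lspace_inj; apply/eqmodP/asboolP.
have /eqmodP/asboolP// : pi_Lfun f = pi_Lfun g 
  by rewrite -[LHS]/(Lspace_of_Lfun f : aeEqMfun _ _) fg.
Qed.

Lemma Lspace_of_LfunK (f : Lfct) :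
  (Lfun_of_Lspace (Lspace_of_Lfun f) : T -> R) = (f : T -> R) %[ae mu].
Proof. exact: repr_pi_Lfun. Qed.

Lemma Lfun_of_LspaceK : cancel Lfun_of_Lspace Lspace_of_Lfun.
Proof.
move=> f; apply: Lspace_inj; rewrite /= -[RHS]reprK.
by apply/eqmodP/asboolP; exact: ae_eq_refl.
Qed.


Let add_Lspace (f g : Lspc) : Lspc :=
  Lspace_of_Lfun (Lfun_of_Lspace f + Lfun_of_Lspace g).
Let opp_Lspace (f : Lspc) : Lspc := Lspace_of_Lfun (- Lfun_of_Lspace f).
Let scale_Lspace (a : R) (f : Lspc) : Lspc :=
  Lspace_of_Lfun (a *: Lfun_of_Lspace f).

Let addE (f g : Lfct) : add_Lspace (Lspace_of_Lfun f) (Lspace_of_Lfun g) =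
  Lspace_of_Lfun (f + g).
Proof.
apply/Lspace_of_LfunP.
have := Lspace_of_LfunK f; have := Lspace_of_LfunK g.
by apply: filterS2 => x /= gx fx Dx; congr (_ + _); [exact: fx|exact: gx].
Qed.

Let oppE (f : Lfct) : opp_Lspace (Lspace_of_Lfun f) = Lspace_of_Lfun (- f).
Proof.
apply/Lspace_of_LfunP; have := Lspace_of_LfunK f.
by apply: filterS => x /= fx Dx; congr (- _); exact: fx.
Qed.

Let scaleE a (f : Lfct) :
  scale_Lspace a (Lspace_of_Lfun f) = Lspace_of_Lfun (a *: f).
Proof.
apply/Lspace_of_LfunP; have := Lspace_of_LfunK f.
by apply: filterS => x /= fx Dx; congr (_ *: _); exact: fx.
Qed.

Let LspaceW (Q : Lspc -> Prop) :
  (forall f, Q (Lspace_of_Lfun f)) -> forall f, Q f.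
Proof. by move=> QL f; rewrite -(Lfun_of_LspaceK f). Qed.

Let addA : associative add_Lspace.
Proof.
do 3![elim/LspaceW => ?]; by rewrite !addE addrA.
Qed.
Let addC : commutative add_Lspace.
Proof. by do 2![elim/LspaceW => ?]; rewrite !addE addrC. Qed.
Let add0 : left_id (Lspace_of_Lfun 0) add_Lspace.
Proof. by elim/LspaceW => ?; rewrite addE add0r. Qed.
Let addN : left_inverse (Lspace_of_Lfun 0) opp_Lspace add_Lspace.
Proof. by elim/LspaceW => ?; rewrite oppE addE addNr. Qed.

HB.instance Definition _ := gen_eqMixin Lspc.
HB.instance Definition _ := gen_choiceMixin Lspc.
HB.instance Definition _ := GRing.isZmodule.Build Lspc addA addC add0 addN.

Lemma Lspace_of_LfunD f g :
  Lspace_of_Lfun (f + g) = Lspace_of_Lfun f + Lspace_of_Lfun g.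
Proof. by rewrite -addE. Qed.

Let scaleA a b (f : Lspc) :
  scale_Lspace a (scale_Lspace b f) = scale_Lspace (a * b) f.
Proof. by elim/LspaceW: f => f; rewrite !scaleE scalerA. Qed.
Let scale1 : left_id 1 scale_Lspace.
Proof. by elim/LspaceW => f; rewrite !scaleE scale1r. Qed.
Let scaleDr : right_distributive scale_Lspace +%R.
Proof.
move=> a; elim/LspaceW => f; elim/LspaceW => g.
by rewrite -Lspace_of_LfunD !scaleE -Lspace_of_LfunD scalerDr.
Qed.
Let scaleDl f : {morph scale_Lspace^~ f : a b / a + b}.
Proof.
elim/LspaceW: f => f a b.
by rewrite !scaleE -Lspace_of_LfunD scalerDl.
Qed.

HB.instance Definition _ := GRing.Zmodule_isLmodule.Build R Lspc
  scaleA scale1 scaleDr scaleDl.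

Lemma Lspace_of_LfunZ a f : Lspace_of_Lfun (a *: f) = a *: Lspace_of_Lfun f.
Proof. by rewrite -scaleE. Qed.

Let norm_Lspace (f : Lspc) : R := fine 'N[mu]_p[EFin \o f]%E.

Let normE (f : Lfct) : norm_Lspace (Lspace_of_Lfun f) = fine 'N[mu]_p[EFin \o f]%E.
Proof.
congr fine; apply: ae_eq_Lnorm => //; last exact: Lspace_of_LfunK.
exact: (@measurable_funPT _ _ _ _ (Lspace_repr (Lspace_of_Lfun f))).
Qed.

Let ler_norm_Lspace f g :
  norm_Lspace (f + g) <= norm_Lspace f + norm_Lspace g.
Proof.
elim/LspaceW: f => f; elim/LspaceW: g => g.
by rewrite -Lspace_of_LfunD !normE ler_LnormD.
Qed.

Let norm_LspaceZ a f : norm_Lspace (a *: f) = `|a| * norm_Lspace f.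
Proof.
elim/LspaceW: f => f; rewrite -Lspace_of_LfunZ !normE.
by apply: EFin_inj; rewrite EFinM !finite_norm_fine LnormZ.
Qed.

Let norm_Lspace_eq0 f : norm_Lspace f = 0 -> f = 0.
Proof.
elim/LspaceW: f => f; rewrite normE => /fine_Lnormr_eq0 f0.
by apply/Lspace_of_LfunP.
Qed.

HB.instance Definition _ := Lmodule_isNormed.Build R Lspc
  ler_norm_Lspace norm_LspaceZ norm_Lspace_eq0.

Lemma Lspace_normE (f : Lspc) : `|f| = fine 'N[mu]_p[EFin \o f]%E.
Proof. by []. Qed.

End LspaceType_normedModType.


Section innerprod.
Context {d} {Omega : measurableType d} {R : realType}.
Variable P : probability Omega R.
Local Notation L2 := (LspaceType2 P).

Definition inner (f g : L2) : R := \int[P]_x (f x * g x).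

Let ae_eq_inner (f f' g g' : Omega -> R) :
  measurable_fun setT f -> measurable_fun setT f' ->
  measurable_fun setT g -> measurable_fun setT g' ->
  f = f' %[ae P] -> g = g' %[ae P] ->
  \int[P]_x (f x * g x) = \int[P]_x (f' x * g' x).
Proof.
move=> mf mf' mg mg' ff' gg'; congr fine; apply: ae_eq_integral => //.
- by apply/measurable_EFinP; exact: measurable_funM.
- by apply/measurable_EFinP; exact: measurable_funM.
- by apply: filterS2 ff' gg' => x ff' gg' Dx; rewrite ff'// gg'.
Qed.

Lemma inner_Lspace_of_Lfun (f g : LfunType P (lee1n 2)) :
  inner (Lspace_of_Lfun f) (Lspace_of_Lfun g) = \int[P]_x (f x * g x).
Proof.
apply: ae_eq_inner => //; do ?exact: Lspace_of_LfunK.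
- exact: (@measurable_funPT _ _ _ _ (Lspace_repr (Lspace_of_Lfun f))).
- exact: (@measurable_funPT _ _ _ _ (Lspace_repr (Lspace_of_Lfun g))).
Qed.


Lemma normr_inner (f : L2) : `|f| ^+ 2 = inner f f.
Proof.
have fN := finite_norm_fine (Lfun_of_Lspace f).
have := @poweR_Lnorm _ _ _ P (EFin \o f) 2 _.
rewrite -fN poweR_EFin powR_mulrn ?fine_ge0 ?Lnorm_ge0// => N2.
apply: EFin_inj; rewrite Lspace_normE N2 ?pnatr_eq0//.
have fE : (\int[P]_x `|(EFin \o f) x| `^ 2 = \int[P]_x (f x * f x)%:E)%E.
  apply: eq_integral => x _ /=.
  by rewrite powR_mulrn// real_normK ?num_real// expr2.
rewrite fE /inner /Rintegral fineK// -fE -N2 ?pnatr_eq0//.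
Qed.
End innerprod.

Section subsets.
Context {R : realType} {V : lmodType R}.
Implicit Types A B : set V.

Definition linear_subspace A : Prop := submod_closed (mem A).

Definition linear_span A : set V := smallest linear_subspace A.

Definition affine_set A : Prop :=
  forall (t : R) x y, A x -> A y -> A (t *: x + (1 - t) *: y).

Definition affine_hull A : set V := smallest affine_set A.

Definition conv_hull A : set V :=
  smallest (fun B : set V => convex_set (B : set (convex_lmodType V))) A.

(* [codim_is A B n]: the quotient A / B has dimension n, witnessed by n vectors
   of A forming a basis of A modulo B. *)
Definition codim_is A B (n : nat) : Prop :=
  exists e : 'I_n -> V,
    [/\ forall i, A (e i),
        forall c : 'I_n -> R, B (\sum_i c i *: e i) -> forall i, c i = 0 &
        A = [set x + y | x in B & y in linear_span (range e)]].

Definition dim_is A (n : nat) : Prop := codim_is A [set 0] n.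

Definition sublinear_on A (g : V -> R) : Prop :=
  (forall (c : R) h, 0 <= c -> A h -> g (c *: h) = c * g h) /\
  (forall h k, A h -> A k -> g (h + k) <= g h + g k).

Definition linear_on A (g : V -> R) : Prop :=
  forall (a : R) u v, A u -> A v -> g (a *: u + v) = a * g u + g v.

End subsets.

Section functional.
Context {R : realType} {H : lmodType R}.
Variables (TT : set H) (g : H -> R).

Definition Nspace : set H := [set h | TT h /\ g h + g (- h) = 0].

Definition core_space : set H :=
  [set w | Nspace w /\
    forall v (c : R), Nspace v -> g (v + c *: w) = g v + c * g w].

Definition additivity_space : set H :=
  [set w | TT w /\ forall h, TT h -> g (h + w) = g h + g w].

Definition linearity_subspaces : set (set H) :=
  [set V | [/\ linear_subspace V, V `<=` TT & linear_on V g]].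

Definition max_linearity_subspaces : set (set H) :=
  [set V | linearity_subspaces V /\
    forall W, linearity_subspaces W -> V `<=` W -> W = V].

End functional.

Definition maximum_of {R : realType} (A : set R) (m : R) : Prop :=
  A m /\ ubound A m.

Definition minimum_of {R : realType} (A : set R) (m : R) : Prop :=
  A m /\ lbound A m.

Section Hilbert.
Context {d} {Omega : measurableType d} {R : realType}.
Variable P : probability Omega R.
Local Notation L2 := (LspaceType2 P).
Implicit Types A V TT : set L2.

Definition L20 : set L2 := [set f | \int[P]_x f x = 0].

Definition orth_compl A : set L2 := [set h | forall f, A f -> inner f h = 0].

(* Projection onto the closure of the linear subspace V; the default value 0 of
   xget is never taken, since L_2(P) is complete. *)
Definition orth_proj V (x : L2) : L2 :=
  xget 0 [set p | closure V p /\ forall h, closure V h -> inner (x - p) h = 0].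

Definition dist_to_set (x : L2) A : R := inf [set `|x - y| | y in A].

Definition orthogonal_sum TT A V : Prop :=
  [/\ TT = [set a + v | a in A & v in V], A `&` V = [set 0] &
      forall a v, A a -> V v -> inner a v = 0].

Definition is_riesz_representer V (g : L2 -> R) (psi : L2) : Prop :=
  closure V psi /\
  exists gbar : L2 -> R,
    [/\ {within closure V, continuous gbar},
        forall h, V h -> gbar h = g h &
        forall h, closure V h -> gbar h = inner psi h].

(* As above, a representer exists as soon as g is linear and continuous on V. *)
Definition riesz_representer V (g : L2 -> R) : L2 :=
  xget 0 [set psi | is_riesz_representer V g psi].

Definition sqnorm_riesz V (g : L2 -> R) : R := `|riesz_representer V g| ^+ 2.

(* Extended-real supremum, so that no default value can arise. *)
Definition Vstar TT (g : L2 -> R) : \bar R :=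
  ereal_sup [set (sqnorm_riesz V g)%:E | V in linearity_subspaces TT g].

Definition Lambda_set TT (g : L2 -> R) : set L2 :=
  [set l | closure TT l /\ forall h, TT h -> inner l h <= g h].

Definition Fspace TT (g : L2 -> R) : set L2 :=
  closure (linear_span [set l1 - l2 | l1 in Lambda_set TT g & l2 in Lambda_set TT g]).

End Hilbert.
Arguments L20 {d Omega R} P.

Section dqm.
Context {d} {Omega : measurableType d} {R : realType}.
Implicit Types P Q : probability Omega R.

Definition dominating P Q : set Omega -> \bar R := measure_add P Q.

HB.instance Definition _ P Q := Measure.on (dominating P Q).

Let dominating_fin_num P Q : fin_num_fun (dominating P Q).
Proof.
by move=> A mA; rewrite /dominating measure_addE fin_numD !fin_num_measure.
Qed.

HB.instance Definition _ P Q :=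
  Measure_isFinite.Build _ _ _ (dominating P Q) (@dominating_fin_num P Q).

Definition sqrt_density (nu : {finite_measure set Omega -> \bar R}) Q
    (x : Omega) : R :=
  Num.sqrt (fine (('d (charge_of_finite_measure Q) '/d nu) x)).

(* The integral of [(dQ^{1/2} - dP^{1/2}) / t - h dP^{1/2} / 2]^2: it does not
   depend on the dominating measure, for which P + Q is chosen. *)
Definition dqm_remainder P Q (h : LspaceType2 P) (t : R) : \bar R :=
  \int[dominating P Q]_x
    (((sqrt_density (dominating P Q) Q x - sqrt_density (dominating P Q) P x)
        / t
      - 2^-1 * h x * sqrt_density (dominating P Q) P x) ^+ 2)%:E.

(* Only the values of [path] on [0, eps[ are relevant. *)
Definition is_dqm_score (PP : set (probability Omega R)) P
    (h : LspaceType2 P) : Prop :=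
  exists eps : R, 0 < eps /\
  exists path : R -> probability Omega R,
    [/\ forall t, 0 <= t < eps -> PP (path t),
        path 0 = P &
        dqm_remainder (path t) h t @[t --> 0^'+] --> 0%E].

Definition assumption1 (PP : set (probability Omega R)) P
    (TT : set (LspaceType2 P)) : Prop :=
  closed TT /\ forall h, TT h -> is_dqm_score PP h.

End dqm.

Section MoorePenrose.
Context {R : realType} {m n : nat}.

Definition is_moore_penrose (A : 'M[R]_(m, n)) (X : 'M[R]_(n, m)) : Prop :=
  [/\ A *m X *m A = A, X *m A *m X = X,
      (A *m X)^T = A *m X & (X *m A)^T = X *m A].

Definition moore_penrose (A : 'M[R]_(m, n)) : 'M[R]_(n, m) :=
  xget 0 [set X | is_moore_penrose A X].

End MoorePenrose.

Definition quad_form {R : realType} {n : nat} (S : 'M[R]_n) (w : 'cV[R]_n) : R :=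
  (w^T *m S *m w) 0 0.

Definition pos_semidef {R : realType} {n : nat} (S : 'M[R]_n) : Prop :=
  S^T = S /\ forall w, 0 <= quad_form S w.

(* Main.v *)
(* Since L_2(P) is complete, a minimising sequence of |h|^2 / 2 + g(h) over a
   subspace converges for every bounded sublinear g, and minus its limit is a
   subgradient of g at 0. For linear g this is the Riesz representation, hence
   also orthogonal projection; in general it makes Lambda nonempty. Applied to
   the sublinear minorant inf_t (g(h + t h0) - t g(h0)) it yields a subgradient
   that attains g(h0), so no Hahn-Banach theorem or weak compactness is needed.
   Consequently N(g) is the set of h on which all elements of Lambda agree, that
   is, the orthocomplement of F in TT. When TT is closed, every l in Lambda
   splits as psi + f with psi in N(g) and f in F, and psi, being orthogonal to
   F, is the point of minimal norm of l + F. For a polytope, the normal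
   equations Sigma w = c 1, with 1^T w = 1, say that the combination of the
   vertices with weights w is orthogonal to F, so it is psi; they are solved
   with c > 0 if 1 lies in the range of Sigma and with c = 0 otherwise. *)

Require Import Defs.
From HB Require Import structures.
From mathcomp Require Import all_boot all_order all_algebra.
From mathcomp Require Import all_classical all_reals all_analysis.
From mathcomp Require Import measurable_realfun ring lra.
Import Order.TTheory GRing.Theory Num.Theory.
Import numFieldNormedType.Exports.
Local Open Scope classical_set_scope.
Local Open Scope ring_scope.

Set Implicit Arguments.
Unset Strict Implicit.
Unset Printing Implicit Defensive.

(** * L2(P) is a Hilbert space *)

Section inner_product.
Context {d : measure_display} {Omega : measurableType d} {R : realType}.
Context {P : probability Omega R}.
Local Notation L2 := (LspaceType2 P).
Local Notation F2 := (LfunType P (lee1n 2)).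
Implicit Types x y z : L2.

Lemma integrable_mul (f g : F2) :
  P.-integrable setT (fun t => (f t * g t)%:E).
Proof. by apply/Lfun1_integrable/Lfun2_mul_Lfun1; exact: LfunP. Qed.

Lemma innerC x y : inner x y = inner y x.
Proof. by rewrite /inner; congr fine; apply: eq_integral => t _; rewrite mulrC. Qed.

Lemma innerDl x y z : inner (x + y) z = inner x z + inner y z.
Proof.
rewrite -(Lfun_of_LspaceK x) -(Lfun_of_LspaceK y) -(Lfun_of_LspaceK z).
rewrite -Lspace_of_LfunD !inner_Lspace_of_Lfun -RintegralD//;
  [|exact: integrable_mul|exact: integrable_mul].
by congr fine; apply: eq_integral => t _ /=; rewrite -mulrDl.
Qed.

Lemma innerZl a x y : inner (a *: x) y = a * inner x y.
Proof.
rewrite -(Lfun_of_LspaceK x) -(Lfun_of_LspaceK y).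
rewrite -Lspace_of_LfunZ !inner_Lspace_of_Lfun -RintegralZl//;
  last exact: integrable_mul.
by congr fine; apply: eq_integral => t _ /=; rewrite mulrA.
Qed.

End inner_product.

(** * Completeness of L_2(P) *)

Section completeness.
Context {d : measure_display} {Omega : measurableType d} {R : realType}.

(** The increments have total integral at most 4, the sum of a geometric series, so their pointwise
    sum is finite almost everywhere; there the telescoping series converges absolutely. *)
Lemma ae_cvg_summable_increments (mu : {measure set Omega -> \bar R})
    (f : nat -> Omega -> R) :
  (forall k, measurable_fun setT (f k)) ->
  (forall k, (\int[mu]_t `|f k.+1 t - f k t|%:E <= (4 / (2 ^ (k + 1))%:R)%:E)%E) ->
  exists2 h : Omega -> R, measurable_fun setT h &
    {ae mu, forall t, f k t @[k --> \oo] --> h t}.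
Proof.
move=> mf hf.
pose a k t : \bar R := `|f k.+1 t - f k t|%:E.
have ma k : measurable_fun setT (a k).
  by apply/measurable_EFinP/measurableT_comp => //; exact: measurable_funB.
have a0 k t : (0 <= a k t)%E by rewrite lee_fin.
(* The upper limit is measurable on the whole space; [fine] only matters where it is infinite, which
   is a null set. *)
exists (fun t => fine (limn_esup (fun k => (f k t)%:E))).
  apply: (measurableT_comp (fine_measurable _)) => //.
  by apply: measurable_fun_limn_esup => k; exact/measurable_EFinP.
have int_a : mu.-integrable setT (fun t => (\sum_(k <oo) a k t)%E).
  apply/integrableP; split.
    by apply: ge0_emeasurable_sum => // k t _ _; exact: a0.
  under eq_integral => t _ do rewrite gee0_abs ?nneseries_ge0//.
  rewrite integral_nneseries//.
  have le4 : (\sum_(k <oo) \int[mu]_t a k t <= (4 / 2 ^+ 0)%:E)%E.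
    have := @cvg_geometric_eseries_half R 4 0.
    move=> /cvg_lim <-//.
    apply: (@lee_nneseries _ (fun k => \int[mu]_t a k t)%E) => k _.
      by move=> _; apply: integral_ge0.
    exact: hf.
  by apply: le_lt_trans le4 _; rewrite ltry.
have := integrable_ae measurableT int_a.
apply: filterS => t /(_ I) fin_sum.
suff : cvgn (fun k => f k t).
  move=> cf; have /cvg_ex[l fl] := cf.
  have /cvg_limn_einf_sup[_ ->] : (f k t)%:E @[k --> \oo] --> l%:E.
    by apply: cvg_EFin => //; exact: nearW.
  exact: fl.
pose u : R^nat := fun k => f k t.
have cs : cvgn (series (telescope u)).
  apply: normed_cvg; apply: nondecreasing_is_cvgn.
    by apply: nondecreasing_series => n _ _; exact: normr_ge0.
  exists (fine (\sum_(k <oo) a k t)) => _ [n _ <-].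
  rewrite -lee_fin fineK//.
  have := @nneseries_lim_ge R (fun k => a k t) xpredT 0 n (fun k _ _ => a0 k t).
  by rewrite /= sumEFin.
have /cvg_ex[l sl] := cs.
apply/cvg_ex; exists (u 0%N + l).
rewrite (_ : (fun k => f k t) = (fun k => u 0%N + series (telescope u) k)).
  by apply: cvgD => //; exact: cvg_cst.
by apply/funext => k; rewrite -eq_sum_telescope.
Qed.

Context {P : probability Omega R}.
Local Notation L2 := (LspaceType2 P).
Local Notation F2 := (LfunType P (lee1n 2)).

Lemma normr_Lspace_of_Lfun (f : F2) :
  ((`|Lspace_of_Lfun f| ^+ 2)%:E = \int[P]_t ((f t) ^+ 2)%:E)%E.
Proof.
rewrite normr_inner inner_Lspace_of_Lfun /Rintegral fineK.
  by apply: eq_integral => t _; rewrite expr2.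
by apply: integrable_fin_num => //; exact: integrable_mul.
Qed.

Lemma Lfun2_of_integral_lty (h : Omega -> R) : measurable_fun setT h ->
  (\int[P]_t ((h t) ^+ 2)%:E < +oo)%E -> h \in Lfun P 2%:E.
Proof.
move=> mh hoo; rewrite inE; apply/andP; split; rewrite inE//=.
rewrite /finite_norm unlock poweR_lty//.
rewrite (_ : (\int[P]_x _)%E = (\int[P]_t ((h t) ^+ 2)%:E)%E)//.
apply: eq_integral => t _ /=.
by rewrite powR_mulrn// real_normK ?num_real.
Qed.

Lemma Lspace_of_LfunB (f g : F2) :
  Lspace_of_Lfun (f - g) = Lspace_of_Lfun f - Lspace_of_Lfun g.
Proof. by rewrite -scaleN1r Lspace_of_LfunD Lspace_of_LfunZ scaleN1r. Qed.

(** Integrate the pointwise bound [|z| <= z^2 / e + e] against a measure of total mass 1. *)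
Lemma integral_normr_le (z : F2) (e : R) : 0 < e ->
  `|Lspace_of_Lfun z| <= e -> (\int[P]_t `|z t|%:E <= (2 * e)%:E)%E.
Proof.
move=> e0 ze; have PT : P setT = 1%E := probability_setT P.
have mz2 : measurable_fun setT (fun t => ((z t) ^+ 2)%:E).
  by apply/measurable_EFinP/measurable_funX.
apply: (@le_trans _ _ (\int[P]_t ((e^-1)%:E * ((z t) ^+ 2)%:E + e%:E))%E).
  apply: ge0_le_integral => //.
  - by apply/measurable_EFinP; apply: measurableT_comp.
  - by apply: emeasurable_funD => //; exact: emeasurable_funM.
  - move=> t _; rewrite lee_fin -(ler_pM2l e0) mulrDr mulrA divff ?gt_eqF//.
    rewrite -[z t ^+ 2]real_normK ?num_real//.
    by have := normr_ge0 (z t); nra.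
rewrite ge0_integralD//; last 3 first.
- by move=> t _; rewrite mule_ge0 ?lee_fin ?invr_ge0 ?sqr_ge0 ?(ltW e0).
- exact: emeasurable_funM.
- by move=> t _; rewrite lee_fin ltW.
rewrite ge0_integralZl//; last 2 first.
- by move=> t _; rewrite lee_fin sqr_ge0.
- by rewrite lee_fin invr_ge0 ltW.
rewrite -normr_Lspace_of_Lfun integral_cst//= PT mule1.
rewrite -EFinM -EFinD lee_fin -(ler_pM2l e0) mulrDr mulrA divff ?gt_eqF//.
by have := normr_ge0 (Lspace_of_Lfun z); nra.
Qed.

Lemma limn_einf_le (v : (\bar R)^nat) (c : \bar R) :
  (exists K, forall k, (K <= k)%N -> (v k <= c)%E) -> (limn_einf v <= c)%E.
Proof.
move=> [K vc]; rewrite limn_einf_lim; apply: lime_le; first exact: is_cvg_einfs.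
exists K => // k Kk; apply: le_trans (vc _ Kk).
by apply: ereal_inf_lbound; exists k => /=.
Qed.

(* A subsequence with geometrically small increments converges almost
   everywhere; Fatou's lemma turns this into convergence in norm. *)
Lemma L2_complete (u : nat -> L2) :
  (forall e, 0 < e -> exists N, forall m n,
     (N <= m)%N -> (N <= n)%N -> `|u m - u n| < e) ->
  exists l, forall e, 0 < e -> exists N, forall n, (N <= n)%N -> `|u n - l| <= e.
Proof.
move=> cu; pose eps k : R := (2 ^ k)%:R^-1.
have eps0 k : 0 < eps k by rewrite invr_gt0 ltr0n expn_gt0.
have /choice[N HN] k := cu _ (eps0 k).
(* The maximum, instead of [N k], puts both [nn k] and [nn k.+1] beyond [N k], which controls
   consecutive increments. *)
pose nn k := (\max_(j < k.+1) N j)%N.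
have nnN j k : (j <= k)%N -> (N j <= nn k)%N.
  rewrite -ltnS => jk.
  exact: (@leq_bigmax _ (fun i : 'I_k.+1 => N i) (Ordinal jk)).
pose f k := Lfun_of_Lspace (u k).
have fE k : u k = Lspace_of_Lfun (f k) by rewrite Lfun_of_LspaceK.
have mf k : measurable_fun setT (f k : Omega -> R) by [].
have [h mh fh] : exists2 h : Omega -> R, measurable_fun setT h &
    {ae P, forall t, f (nn k) t @[k --> \oo] --> h t}.
  apply: ae_cvg_summable_increments => // k.
  have := @integral_normr_le (f (nn k.+1) - f (nn k)) (eps k) (eps0 k).
  rewrite Lspace_of_LfunB -!fE => /(_ (ltW (HN _ _ _ _ _))).
  rewrite !nnN// => /(_ erefl erefl); congr (_ <= _)%E.
  (* The bound [2 * eps k] is [4 / 2 ^ (k + 1)]; this is the origin of the constant 4. *)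
  by rewrite addn1 /eps expnS natrM invfM mulrA; congr (_ * _)%:E; field.
(* Fatou's lemma in [k] with [m] fixed: a bound on the distances from [u m] along the subsequence
   passes to the almost-everywhere limit [h]. *)
have hfm m e : 0 <= e ->
    (exists K, forall k, (K <= k)%N -> `|u (nn k) - u m| <= e) ->
    (\int[P]_t ((h t - f m t) ^+ 2)%:E <= (e ^+ 2)%:E)%E.
  move=> e0 [K ue].
  pose v k t := ((f (nn k) t - f m t) ^+ 2)%:E.
  have mv k : measurable_fun setT (v k).
    by apply/measurable_EFinP/measurable_funX/measurable_funB.
  rewrite (_ : (\int[P]_t _)%E = (\int[P]_t limn_einf (v ^~ t))%E); last first.
    apply: ae_eq_integral => //.
    - by apply/measurable_EFinP/measurable_funX/measurable_funB.
    - rewrite (_ : (fun t => _) = (fun t => - limn_esup (fun k => - v k t))%E)//.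
      apply: measurableT_comp => //.
      by apply: measurable_fun_limn_esup => k; exact: measurableT_comp.
    - apply: filterS fh => t fht _.
      suff /cvg_limn_einf_sup[->] : v k t @[k --> \oo] --> ((h t - f m t) ^+ 2)%:E.
        by [].
      apply: cvg_EFin; first exact: nearW.
      rewrite expr2.
      have cvg_diff : f (nn k) t - f m t @[k --> \oo] --> h t - f m t.
        by apply: cvgB => //; exact: cvg_cst.
      exact: (cvgM cvg_diff cvg_diff).
  have v0 k t : setT t -> (0 <= v k t)%E by rewrite lee_fin sqr_ge0.
  apply: (le_trans (fatou P measurableT mv v0)).
  apply: limn_einf_le; exists K => k Kk.
  have -> : (\int[P]_t v k t = (`|u (nn k) - u m| ^+ 2)%:E)%E.
    by rewrite !fE -Lspace_of_LfunB normr_Lspace_of_Lfun.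
  by rewrite lee_fin ler_sqr ?nnegrE ?ue.
have hfmN j m : (N j <= m)%N ->
    (\int[P]_t ((h t - f m t) ^+ 2)%:E <= (eps j ^+ 2)%:E)%E.
  move=> jm; apply: hfm; first exact: ltW.
  by exists j => k jk; apply: ltW; apply: HN => //; exact: nnN.
have hL : h \in Lfun P 2%:E.
  have hfL : h - f (N 0%N) \in Lfun P 2%:E.
    apply: Lfun2_of_integral_lty; first exact: measurable_funB.
    by apply: le_lt_trans (hfmN 0%N _ (leqnn _)) _; rewrite ltry.
  have -> : h = (h - f (N 0%N)) + f (N 0%N) by rewrite subrK.
  by apply: (Lfun_addr_closed P (lee1n 2)).2 => //; exact: LfunP.
pose hf : F2 := Lfun_Sub (lee1n 2) hL.
exists (Lspace_of_Lfun hf) => e e0.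
have [j je] : exists j, eps j <= e.
  exists (Num.truncn e^-1).+1; rewrite -[leRHS]invrK /eps.
  rewrite lef_pV2 ?posrE ?invr_gt0 ?ltr0n ?expn_gt0//.
  apply: ltW; apply: lt_trans (truncnS_gt _) _.
  by rewrite ltr_nat ltn_expl.
exists (N j) => n jn; apply: le_trans je.
rewrite -ler_sqr ?nnegrE ?(ltW (eps0 j))// distrC fE -Lspace_of_LfunB.
by rewrite -lee_fin normr_Lspace_of_Lfun hfmN.
Qed.

End completeness.

(** * Linear subspaces, spans and closures *)

Section linear_subspaces.
Context {R : realType} {V : lmodType R}.
Context {A : set V} (A_sub : linear_subspace A).

Lemma linear_subspace0 : A 0.
Proof. by have [/set_mem] := A_sub. Qed.

Lemma linear_subspaceP a x y : A x -> A y -> A (a *: x + y).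
Proof.
by move=> /mem_set Ax /mem_set Ay; apply: set_mem; exact: A_sub.2.
Qed.

Lemma linear_subspaceD x y : A x -> A y -> A (x + y).
Proof. by move=> Ax Ay; rewrite -[x]scale1r; exact: linear_subspaceP. Qed.

Lemma linear_subspaceZ a x : A x -> A (a *: x).
Proof.
by move=> Ax; rewrite -[_ *: _]addr0; apply: linear_subspaceP linear_subspace0.
Qed.

Lemma linear_subspaceN x : A x -> A (- x).
Proof. by rewrite -scaleN1r; exact: linear_subspaceZ. Qed.

Lemma linear_subspaceB x y : A x -> A y -> A (x - y).
Proof. by move=> Ax Ay; apply/linear_subspaceD/linear_subspaceN. Qed.

Lemma linear_subspace_sum (I : finType) (c : I -> R) (v : I -> V) :
  (forall i, A (v i)) -> A (\sum_i c i *: v i).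
Proof.
move=> Av; apply: (big_ind A); [exact: linear_subspace0|exact: linear_subspaceD|].
by move=> i _; exact: linear_subspaceZ.
Qed.

End linear_subspaces.

Lemma linear_subspaceI {R : realType} {V : lmodType R} (A : set V) : A 0 ->
  (forall a x y, A x -> A y -> A (a *: x + y)) -> linear_subspace A.
Proof.
move=> A0 AP; split; first exact: mem_set.
by move=> a x y /set_mem Ax /set_mem Ay; apply: mem_set; exact: AP.
Qed.

Lemma linear_span_sub {R : realType} {V : lmodType R} (A B : set V) :
  linear_subspace B -> A `<=` B -> linear_span A `<=` B.
Proof. by move=> linB AB x; apply. Qed.

Lemma sub_linear_span {R : realType} {V : lmodType R} (A : set V) :
  A `<=` linear_span A.
Proof. by move=> x Ax B [_]; apply. Qed.

Lemma linear_span_subspace {R : realType} {V : lmodType R} (A : set V) :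
  linear_subspace (linear_span A).
Proof.
apply: linear_subspaceI => [B [linB _]|a x y Ax Ay B BA].
  exact: linear_subspace0.
by apply: linear_subspaceP; [exact: BA.1|exact: Ax|exact: Ay].
Qed.

Lemma normed_closureP {R : realType} {V : normedModType R} (A : set V) x :
  closure A x <-> forall e, 0 < e -> exists2 y, A y & `|x - y| < e.
Proof.
split=> [Ax e e0|Ax B].
  have [y [Ay /= xy]] := Ax _ (nbhsx_ballx x _ e0).
  by exists y => //; move: xy; rewrite -ball_normE.
move=> /nbhs_ballP[e /= e0 eB]; have [y Ay xy] := Ax _ e0.
by exists y; split => //; apply: eB; rewrite -ball_normE.
Qed.

Lemma closure_linear_subspace {R : realType} {V : normedModType R} (A : set V) :
  linear_subspace A -> linear_subspace (closure A).
Proof.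
move=> linA; apply: linear_subspaceI.
  by apply: subset_closure; exact: linear_subspace0.
move=> a x y /normed_closureP Ax /normed_closureP Ay.
apply/normed_closureP => e e0.
have a1 : 0 < `|a| + 1 by rewrite ltr_wpDl.
have [x' Ax' xx'] : exists2 x', A x' & `|x - x'| < e / 2 / (`|a| + 1).
  by apply: Ax; rewrite divr_gt0// divr_gt0.
have [y' Ay' yy'] : exists2 y', A y' & `|y - y'| < e / 2.
  by apply: Ay; rewrite divr_gt0.
exists (a *: x' + y'); first exact: linear_subspaceP.
rewrite opprD addrACA -scalerBr (splitr e).
apply: le_lt_trans (ler_normD _ _) _; apply: ler_ltD => //.
rewrite normrZ; move: xx'; rewrite ltr_pdivlMr// => /ltW.
by apply: le_trans; rewrite mulrC ler_wpM2l// lerDl.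
Qed.

Lemma closure_le {R : realType} {V : normedModType R} (f : V -> R) (A : set V)
  (c : R) : continuous f -> (forall x, A x -> f x <= c) ->
  forall x, closure A x -> f x <= c.
Proof.
move=> cf Ac x Ax.
have clf : closed (f @^-1` [set y | y <= c]).
  by apply: closed_comp; [move=> ? _; exact: cf|exact: closed_le].
have := closure_subset (B := f @^-1` [set y | y <= c]) Ac Ax.
by rewrite -(proj1 (closure_id _) clf).
Qed.

Lemma lipschitz_continuous {R : realType} {V : normedModType R} (f : V -> R)
  (C : R) : (forall x y, `|f x - f y| <= C * `|x - y|) -> continuous f.
Proof.
move=> fC x; apply/cvgrPdist_le => e e0.
have C1 : 0 < `|C| + 1 by rewrite ltr_wpDl.
near=> y; apply: le_trans (fC _ _) _.
apply: (@le_trans _ _ ((`|C| + 1) * `|x - y|)).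
  by rewrite ler_wpM2r// ler_wpDr// ler_norm.
rewrite -ler_pdivlMl//; near: y.
by apply: cvgr_dist_le => //; rewrite mulr_gt0 ?invr_gt0.
Unshelve. all: by end_near. Qed.

(** * Inner product calculus and minimisation over a subspace *)

Section hilbert.
Context {d : measure_display} {Omega : measurableType d} {R : realType}.
Context {P : probability Omega R}.
Local Notation L2 := (LspaceType2 P).
Implicit Types x y z : L2.

Lemma innerDr x y z : inner z (x + y) = inner z x + inner z y.
Proof. by rewrite innerC innerDl !(innerC z). Qed.

Lemma innerZr a x y : inner x (a *: y) = a * inner x y.
Proof. by rewrite innerC innerZl innerC. Qed.

Lemma innerNl x y : inner (- x) y = - inner x y.
Proof. by rewrite -scaleN1r innerZl mulN1r. Qed.

Lemma innerNr x y : inner x (- y) = - inner x y.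
Proof. by rewrite innerC innerNl innerC. Qed.

Lemma innerBl x y z : inner (x - y) z = inner x z - inner y z.
Proof. by rewrite innerDl innerNl. Qed.

Lemma innerBr x y z : inner z (x - y) = inner z x - inner z y.
Proof. by rewrite innerDr innerNr. Qed.

Lemma inner0l x : inner 0 x = 0.
Proof. by rewrite -(scale0r 0) innerZl mul0r. Qed.

Lemma inner0r x : inner x 0 = 0.
Proof. by rewrite innerC inner0l. Qed.

Lemma inner_suml (I : Type) (r : seq I) (Q : pred I) (v : I -> L2) x :
  inner (\sum_(i <- r | Q i) v i) x = \sum_(i <- r | Q i) inner (v i) x.
Proof.
by apply: (big_morph (fun y => inner y x)) => [y z|]; rewrite ?innerDl ?inner0l.
Qed.

Lemma inner_sumr (I : Type) (r : seq I) (Q : pred I) (v : I -> L2) x :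
  inner x (\sum_(i <- r | Q i) v i) = \sum_(i <- r | Q i) inner x (v i).
Proof. by rewrite innerC inner_suml; apply: eq_bigr => i _; exact: innerC. Qed.

Lemma inner_eq0 x : inner x x = 0 -> x = 0.
Proof.
by rewrite -normr_inner => /eqP; rewrite expf_eq0 => /andP[_ /eqP/normr0_eq0].
Qed.

Lemma inner_ge0 x : 0 <= inner x x.
Proof. by rewrite -normr_inner sqr_ge0. Qed.

Lemma innerD_sqr x y :
  inner (x + y) (x + y) = inner x x + 2 * inner x y + inner y y.
Proof. by rewrite !innerDl !innerDr (innerC y x); ring. Qed.

Lemma innerB_sqr x y :
  inner (x - y) (x - y) = inner x x - 2 * inner x y + inner y y.
Proof. by rewrite innerD_sqr !innerNl !innerNr opprK mulrN. Qed.

Lemma inner_normr x : inner x x = `|x| * `|x| :> R.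
Proof. by rewrite -normr_inner expr2. Qed.

Lemma normr_le_inner x (e : R) : 0 <= e -> (`|x| <= e) = (inner x x <= e ^+ 2).
Proof. by move=> e0; rewrite -normr_inner ler_sqr ?nnegrE. Qed.

Lemma normr_lt_inner x (e : R) : 0 <= e -> (`|x| < e) = (inner x x < e ^+ 2).
Proof. by move=> e0; rewrite -normr_inner ltr_sqr ?nnegrE. Qed.

(** Cauchy-Schwarz: expand the squared norm of [|y| x - |x| y] and divide by [|x| |y|]. *)
Lemma inner_le_norm x y : inner x y <= `|x| * `|y|.
Proof.
have [->|y0] := eqVneq y 0; first by rewrite inner0r normr0 mulr0.
have ny : 0 < `|y| :> R by rewrite normr_gt0.
have [->|x0] := eqVneq x 0; first by rewrite inner0l normr0 mul0r.
have nx : 0 < `|x| :> R by rewrite normr_gt0.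
have := inner_ge0 (`|y| *: x - `|x| *: y).
rewrite innerB_sqr !(innerZl, innerZr) !inner_normr.
move: (`|x| : R) (`|y| : R) nx ny => u v u0 v0 h.
by rewrite -(ler_pM2l (mulr_gt0 u0 v0)); nra.
Qed.

Lemma normr_inner_le x y : `|inner x y| <= `|x| * `|y|.
Proof.
rewrite ler_norml inner_le_norm andbT lerNl -innerNl.
by rewrite -(normrN x) inner_le_norm.
Qed.

Lemma inner_continuous z : continuous (inner z).
Proof.
apply: (@lipschitz_continuous _ _ _ `|z|) => x y.
by rewrite -innerBr normr_inner_le.
Qed.

Lemma inner_closure0 (A : set L2) z : (forall x, A x -> inner z x = 0) ->
  forall x, closure A x -> inner z x = 0.
Proof.
move=> Az x Ax; apply: le_anti; apply/andP; split.
  apply: (@closure_le _ _ (inner z) A 0 (@inner_continuous z)) => // y /Az->.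
  by [].
rewrite -oppr_le0 -innerNl.
apply: (@closure_le _ _ (inner (- z)) A 0 (@inner_continuous (- z))) => // y /Az.
by rewrite innerNl => ->; rewrite oppr0.
Qed.

(** Subadditivity gives [0 = g 0 <= g h + g (- h)]; then apply the upper bound at [- h]. *)
Lemma sublinear_lower_bound (TT : set L2) (g : L2 -> R) (C : R) :
  linear_subspace TT -> sublinear_on TT g ->
  (forall h, TT h -> g h <= C * `|h|) -> forall h, TT h -> - (C * `|h|) <= g h.
Proof.
move=> linT [gZ gD] gC h Th.
have TNh := linear_subspaceN linT Th.
have := gD _ _ Th TNh; rewrite subrr.
have := gZ 0 0 (lexx _) (linear_subspace0 linT); rewrite scale0r mul0r => ->.
by have := gC _ TNh; rewrite normrN; lra.
Qed.

(* Minimise [`|h|^2 / 2 + g h] over TT: the first-order condition at the limit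
   [p] of a minimising sequence says that [- p] is a subgradient of g at 0. *)
Lemma subgradient_exists (TT : set L2) (g : L2 -> R) (C : R) :
  linear_subspace TT -> sublinear_on TT g -> 0 <= C ->
  (forall h, TT h -> g h <= C * `|h|) ->
  exists l, closure TT l /\ forall h, TT h -> inner l h <= g h.
Proof.
move=> linT subg C0 gC.
have gC' := sublinear_lower_bound linT subg gC.
have [gZ gD] := subg.
pose Phi (h : L2) : R := inner h h / 2 + g h.
pose E := [set Phi h | h in TT].
(* Completing the square in [|h|^2 / 2 - C |h|] gives the constant. *)
have lbE : lbound E (- (C ^+ 2 / 2)).
  move=> _ [h Th <-]; rewrite /Phi inner_normr.
  have := gC' _ Th; have := sqr_ge0 (C - `|h|).
  by move: (g h) (`|h| : R) => u v; nra.
have infE : has_inf E.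
  by split; [exists (Phi 0), 0 => //; exact: linear_subspace0|exists (- (C ^+ 2 / 2))].
pose m : R := inf E.
pose r n : R := n.+1%:R^-1.
have mPhi h : TT h -> m <= Phi h by move=> Th; apply: (ge_inf infE.2); exists h.
have /choice[p Hp] n : exists p, TT p /\ Phi p < m + r n.
  have n0 : 0 < r n by rewrite invr_gt0 ltr0n.
  by have [_ [p Tp <-] mp] := inf_adherent n0 infE; exists p.
(* The value of [Phi] at the midpoint is at least [m], while by the parallelogram law and
   subadditivity it lies below the mean of [Phi (p i)] and [Phi (p j)] by at least
   [|p i - p j|^2 / 8]. *)
have p_close i j :
    inner (p i - p j) (p i - p j) <= 4 * (r i + r j).
  have [Ti pi] := Hp i; have [Tj pj] := Hp j.
  have Tij := linear_subspaceD linT Ti Tj.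
  have := mPhi _ (linear_subspaceZ linT (2^-1 : R) Tij).
  rewrite /Phi gZ ?invr_ge0// innerZl innerZr (innerD_sqr _ (p j)) innerB_sqr.
  by move: pi pj (gD _ _ Ti Tj); rewrite /Phi; lra.
have inv_small e : 0 < e -> exists N, forall n, (N <= n)%N -> r n <= e.
  move=> e0; exists (Num.truncn e^-1) => n Nn.
  rewrite -[leRHS]invrK /r lef_pV2 ?posrE ?invr_gt0 ?ltr0n//.
  by apply: ltW; apply: lt_le_trans (truncnS_gt _) _; rewrite ler_nat.
have [|q Hq] := @L2_complete _ _ _ P p.
  move=> e e0; have e2 : 0 < e ^+ 2 by rewrite exprn_gt0.
  have [|N HN] := inv_small (e ^+ 2 / 16); first by rewrite divr_gt0.
  exists N => i j Ni Nj; rewrite normr_lt_inner ?ltW//.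
  by have := p_close i j; have := HN _ Ni; have := HN _ Nj; lra.
have clq : closure TT q.
  apply/normed_closureP => e e0; have [|N HN] := Hq (e / 2); first by rewrite divr_gt0.
  exists (p N); first exact: (Hp N).1.
  rewrite distrC; apply: le_lt_trans (HN _ (leqnn _)) _.
  by rewrite ltr_pdivrMr// ltr_pMr// ltr1n.
exists (- q); split.
  exact: (linear_subspaceN (closure_linear_subspace linT) clq).
move=> h Th; rewrite innerNl.
(* The limit [q] is only known to lie in the closure of [TT], so [p n], not [q], is perturbed by
   [t h]. The factor [K] splits [e] between the minimisation error [r n] and the error of replacing
   [p n] by [q] in the cross term. *)
have variation t : 0 < t ->
    0 <= t * inner q h + t ^+ 2 * (inner h h / 2) + t * g h.
  move=> t0; apply/ler_addgt0Pr => e e0.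
  pose K : R := 1 + t * `|h|.
  have K0 : 0 < K by rewrite ltr_wpDr// mulr_ge0// ltW.
  have eK : 0 < e / K by rewrite divr_gt0.
  have [N1 HN1] := Hq _ eK; have [N2 HN2] := inv_small _ eK.
  pose n := maxn N1 N2.
  have [Tn pn] := Hp n.
  have Tth := linear_subspaceZ linT t Th.
  have := mPhi _ (linear_subspaceD linT Tn Tth).
  have := gD _ _ Tn Tth; rewrite (gZ _ _ (ltW t0) Th).
  rewrite /Phi innerD_sqr innerZr innerZl innerZr.
  have ip : inner (p n) h <= inner q h + e / K * `|h|.
    rewrite -lerBlDl -innerBl; apply: le_trans (inner_le_norm _ _) _.
    by rewrite ler_wpM2r// HN1// leq_maxl.
  have ipt := ler_wpM2l (ltW t0) ip.
  have n2 := HN2 n (leq_maxr _ _).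
  have eE : e = e / K + t * (e / K * `|h|).
    by rewrite /K; field; rewrite gt_eqF.
  by move: pn n2 ipt eE; rewrite /Phi -/K; move: (e / K) => f; lra.
(* Divide by [t] and let it tend to 0: at [t = e / K] the remaining quadratic term is at most
   [e]. *)
have lim_t : 0 <= inner q h + g h.
  apply/ler_addgt0Pr => e e0.
  pose K := inner h h / 2 + 1.
  have K0 : 0 < K by rewrite ltr_wpDl// divr_ge0// inner_ge0.
  have t0 : 0 < e / K by rewrite divr_gt0.
  have : e / K * (inner h h / 2) <= e.
    by rewrite mulrAC ler_pdivrMr// ler_wpM2l ?(ltW e0)// lerDl.
  have := variation _ t0.
  rewrite expr2 -[_ * _ * (_ / 2)]mulrA -!mulrDr pmulr_rge0//.
  by lra.
by lra.
Qed.

End hilbert.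

(** * Affine and convex sets *)

Lemma closure_translation {R : realType} {V : normedModType R} (A : set V) l x :
  closure [set y | A (l + y)] x -> closure A (l + x).
Proof.
move=> /normed_closureP Ax; apply/normed_closureP => e /Ax[y Ay xy].
by exists (l + y) => //; rewrite opprD addrACA subrr add0r.
Qed.

Lemma closure_affine {R : realType} {V : normedModType R} (A : set V) :
  affine_set A -> affine_set (closure A).
Proof.
move=> affA t x y /normed_closureP Ax /normed_closureP Ay.
apply/normed_closureP => e e0.
pose K : R := `|t| + `|1 - t| + 1.
have K0 : 0 < K by rewrite ltr_wpDl ?addr_ge0.
have eK : 0 < e / K by rewrite divr_gt0.
have [x' Ax' xx'] := Ax _ eK; have [y' Ay' yy'] := Ay _ eK.
exists (t *: x' + (1 - t) *: y'); first exact: affA.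
rewrite opprD addrACA -!scalerBr; apply: le_lt_trans (ler_normD _ _) _.
rewrite !normrZ.
apply: (@le_lt_trans _ _ (`|t| * (e / K) + `|1 - t| * (e / K))).
  by rewrite lerD// ler_wpM2l// ltW.
by rewrite -mulrDl mulrCA gtr_pMr// ltr_pdivrMr// mul1r ltrDl.
Qed.

Lemma affine_hull_affine {R : realType} {V : lmodType R} (A : set V) :
  affine_set (affine_hull A).
Proof.
move=> t x y Ax Ay B BA; apply: BA.1; [exact: Ax|exact: Ay].
Qed.

Lemma sub_affine_hull {R : realType} {V : lmodType R} (A : set V) :
  A `<=` affine_hull A.
Proof. by move=> x Ax B [_]; apply. Qed.

(** Scaling a direction is an affine combination with the base point [l]. For a sum, take the
    midpoint of [l + a x] and [l + y] and dilate it from [l] by the factor 2. *)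
Lemma affine_direction {R : realType} {V : lmodType R} (A : set V) l :
  affine_set A -> A l -> linear_subspace [set x | A (l + x)].
Proof.
move=> affA Al; apply: linear_subspaceI => [|a x y /= Ax Ay]; first by rewrite /= addr0.
have Aax : A (l + a *: x).
  have -> : l + a *: x = a *: (l + x) + (1 - a) *: l.
    by rewrite scalerDr scalerBl scale1r [RHS]addrC addrA subrK.
  exact: affA.
have -> : l + (a *: x + y) =
    2 *: (2^-1 *: (l + a *: x) + (1 - 2^-1) *: (l + y)) + (1 - 2) *: l.
  rewrite (_ : 1 - 2^-1 = 2^-1 :> R); last by field.
  rewrite (_ : 1 - 2 = - 1 :> R); last by ring.
  rewrite -scalerDr scalerA divff// scale1r scaleN1r.
  by rewrite [LHS]addrA [l + y]addrC [X in _ = X - _]addrA addrK.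
by apply: (affA 2) => //; exact: affA.
Qed.

Lemma bounded_setI {R : realType} {V : normedModType R} (A : set V) (C : R) :
  (forall x, A x -> `|x| <= C) -> bounded_set A.
Proof.
move=> AC; exists C; split; first exact: num_real.
by move=> M CM x Ax; apply: le_trans (AC _ Ax) _; exact: ltW.
Qed.

Lemma convex_set_lmodP {R : realType} {V : lmodType R} (A : set V) :
  convex_set (A : set (convex_lmodType V)) <->
  forall (t : R) x y, 0 <= t <= 1 -> A x -> A y -> A (t *: x + (1 - t) *: y).
Proof.
split=> [cA t x y /andP[t0 t1] Ax Ay|cA x y t /set_mem Ax /set_mem Ay].
  have := cA x y (Itv01 t0 t1) (mem_set Ax) (mem_set Ay).
  by move=> /set_mem.
by apply: mem_set; apply: cA => //; rewrite ge0 le1.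
Qed.

(** * Riesz representation and orthogonal projection *)

Section representation.
Context {d : measure_display} {Omega : measurableType d} {R : realType}.
Context {P : probability Omega R}.
Local Notation L2 := (LspaceType2 P).
Implicit Types (x y z h l : L2) (V : set L2) (g : L2 -> R).

Lemma orth_closure_span (A : set L2) h : (forall x, A x -> inner x h = 0) ->
  forall x, closure (linear_span A) x -> inner x h = 0.
Proof.
move=> Ah x Ax; rewrite innerC.
move: Ax; apply: inner_closure0 => y Ay.
rewrite innerC; move: y Ay.
apply: (@linear_span_sub _ _ _ [set y | inner y h = 0]); last exact: Ah.
apply: linear_subspaceI => [|a u v /= u0 v0]; first exact: inner0l.
by rewrite innerDl innerZl u0 v0 mulr0 addr0.
Qed.

(** The difference [x - y] lies in the closure of [V] and is orthogonal to [V], hence to itself.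
    This gives uniqueness of representers and projections. *)
Lemma closure_inner_inj V x y : linear_subspace V -> closure V x ->
  closure V y -> (forall h, V h -> inner x h = inner y h) -> x = y.
Proof.
move=> linV Vx Vy xy; apply/eqP; rewrite -subr_eq0; apply/eqP/inner_eq0.
apply: (inner_closure0 (A := V)) => [h Vh|].
  by rewrite innerBl xy// subrr.
exact: (linear_subspaceB (closure_linear_subspace linV)).
Qed.

Lemma linear_on_sublinear V g : linear_subspace V -> linear_on V g ->
  sublinear_on V g.
Proof.
move=> linV ling; have V0 := linear_subspace0 linV.
have g0 : g 0 = 0 by have := ling 1 _ _ V0 V0; rewrite scaler0 addr0; lra.
split=> [c h _ Vh|h k Vh Vk].
  by rewrite -[c *: h]addr0 ling// g0 addr0.
by rewrite -[h]scale1r ling// mul1r scale1r.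
Qed.

(** For linear [g], the subgradient inequality at [- h] reverses the one at [h]. *)
Lemma riesz_exists V g (C : R) : linear_subspace V -> linear_on V g -> 0 <= C ->
  (forall h, V h -> g h <= C * `|h|) ->
  exists2 p, closure V p & forall h, V h -> inner p h = g h.
Proof.
move=> linV ling C0 gC; have subg := linear_on_sublinear linV ling.
have [p [Vp pg]] := subgradient_exists linV subg C0 gC.
exists p => // h Vh; apply: le_anti; rewrite pg//=.
have := pg _ (linear_subspaceN linV Vh); rewrite innerNr.
have V0 := linear_subspace0 linV.
have := ling (-1) _ _ Vh V0; rewrite addr0 scaleN1r => ->.
by have := subg.1 0 0 (lexx _) V0; rewrite scale0r mul0r; lra.
Qed.

(** The projection of [x] is the Riesz representer of [inner x] on [V]. *)
Lemma orth_proj_exists V x : linear_subspace V ->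
  exists2 p, closure V p & forall h, V h -> inner p h = inner x h.
Proof.
move=> linV; apply: (@riesz_exists V (inner x) `|x|) => //.
- by move=> a u v _ _; rewrite innerDr innerZr.
- by move=> h _; exact: inner_le_norm.
Qed.

(** [inner p] itself serves as the continuous extension, and any other representer agrees with [p]
    on [V]; thus [xget] returns [p]. *)
Lemma riesz_representerE V g p : linear_subspace V -> closure V p ->
  (forall h, V h -> inner p h = g h) -> riesz_representer V g = p.
Proof.
move=> linV Vp pg; apply: xget_unique.
  split => //; exists (inner p); split => //.
  exact/continuous_subspaceT/inner_continuous.
move=> y [Vy [gbar [_ gbarg gbary]]]; apply: (closure_inner_inj linV Vy Vp).
by move=> h Vh; rewrite pg// -gbarg// gbary//; exact: subset_closure.
Qed.

Lemma orth_projE V x p : linear_subspace V -> closure V p ->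
  (forall h, V h -> inner p h = inner x h) -> orth_proj V x = p.
Proof.
move=> linV Vp px; apply: xget_unique.
  split => // h; apply: inner_closure0 => k Vk.
  by rewrite innerBl px// subrr.
move=> y [Vy yx]; apply: (closure_inner_inj linV Vy Vp) => h Vh.
have := yx h (subset_closure Vh); rewrite innerBl px// => /eqP.
by rewrite subr_eq0 => /eqP.
Qed.

(** Continuity at 0 gives [g < 1] on the part of [TT] of norm below some [e]. Rescaling [h] to norm
    [e / 2], strictly inside that ball, yields the constant [2 / e]. *)
Lemma continuous_sublinear_bound (TT : set L2) g : linear_subspace TT ->
  sublinear_on TT g -> {within TT, continuous g} ->
  exists2 C, 0 <= C & forall h, TT h -> g h <= C * `|h|.
Proof.
move=> linT [gZ gD] cg; have T0 := linear_subspace0 linT.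
have g0 : g 0 = 0.
  by have := gZ 0 0 (lexx _) T0; rewrite scale0r mul0r.
have [e e0 eg] : exists2 e : R, 0 < e & forall h, TT h -> `|h| < e -> g h < 1.
  move/subspace_continuousP : cg => /(_ 0 T0).
  move=> /cvgrPdist_lt /(_ 1 ltr01).
  rewrite near_withinE => /nbhs_ballP[e /= e0 eP]; exists e => // h Th he.
  have := eP h; rewrite -ball_normE/= sub0r normrN => /(_ he Th) gh.
  have {}gh : `|g 0 - g h| < 1 by exact: gh.
  by apply: le_lt_trans gh; rewrite g0 sub0r normrN ler_norm.
exists (2 / e) => [|h Th]; first by rewrite divr_ge0// ltW.
have [->|h0] := eqVneq h 0; first by rewrite g0 normr0 mulr0.
have nh : 0 < `|h| :> R by rewrite normr_gt0.
pose c : R := e / 2 / `|h|.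
have c0 : 0 < c by rewrite !divr_gt0.
have := eg (c *: h) (linear_subspaceZ linT _ Th).
rewrite normrZ gtr0_norm// /c divfK ?gt_eqF// gtr_pMr// invf_lt1// ltr1n.
move=> /(_ isT); rewrite gZ ?(ltW c0)// => gc.
have -> : 2 / e * `|h| = c^-1 by rewrite /c; field; rewrite !gt_eqF.
by rewrite -[leRHS]mulr1 ler_pdivlMl ?ltW.
Qed.

End representation.

(** * The subdifferential at 0 *)

Section lambda.
Context {d : measure_display} {Omega : measurableType d} {R : realType}.
Context {P : probability Omega R}.
Local Notation L2 := (LspaceType2 P).
Implicit Types (x y z h l w : L2).
Context {TT : set L2} {g : L2 -> R} {C : R}.
Hypotheses (linT : linear_subspace TT) (subg : sublinear_on TT g).
Hypotheses (C0 : 0 <= C) (gC : forall h, TT h -> g h <= C * `|h|).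
Local Notation Lam := (Lambda_set TT g).
Local Notation F := (Fspace TT g).
Local Notation N := (Nspace TT g).

Let TT0 : TT 0 := linear_subspace0 linT.
Let TTN h : TT h -> TT (- h) := @linear_subspaceN _ _ _ linT h.
Let TTZ (a : R) h : TT h -> TT (a *: h) := @linear_subspaceZ _ _ _ linT a h.
Let TTD h k : TT h -> TT k -> TT (h + k) := @linear_subspaceD _ _ _ linT h k.

Lemma sublinear0 : g 0 = 0.
Proof. by have := subg.1 0 0 (lexx _) TT0; rewrite scale0r mul0r. Qed.

(* The sublinear functional [h |-> inf_t (g (h + t h0) - t g h0)] lies below g
   and takes a value at [- h0] at most [- g h0], so that each of its
   subgradients is exposed by [h0]. *)
Lemma Lambda_attained h0 : TT h0 -> exists2 l, Lam l & inner l h0 = g h0.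
Proof.
move=> Th0; have [gZ gD] := subg.
pose E h : set R := [set g (h + t *: h0) - t * g h0 | t in [set t | 0 <= t]].
pose g' h : R := inf (E h).
have Eh h t : 0 <= t -> E h (g (h + t *: h0) - t * g h0) by exists t.
(* Subadditivity for [t h0 = - h + (h + t h0)]; the infimum is therefore finite. *)
have E_lb h : TT h -> lbound (E h) (- g (- h)).
  move=> Th _ [t /= t0 <-]; have Tt := TTZ t Th0.
  have := gD _ _ (TTN Th) (TTD Th Tt); rewrite addrA addNr add0r (gZ _ _ t0 Th0).
  by lra.
have g'_le h t : TT h -> 0 <= t -> g' h <= g (h + t *: h0) - t * g h0.
  by move=> Th t0; apply: ge_inf; [exists (- g (- h)); exact: E_lb|exact: Eh].
have le_g' h (b : R) : (forall t, 0 <= t -> b <= g (h + t *: h0) - t * g h0) ->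
    b <= g' h.
  move=> bE; apply: lb_le_inf; last by move=> _ [t /= t0 <-]; exact: bE.
  by exists (g (h + 0 *: h0) - 0 * g h0); exact: Eh.
have g'_g h : TT h -> g' h <= g h.
  by move=> Th; have := g'_le h 0 Th (lexx _); rewrite scale0r addr0 mul0r subr0.
(* Substitute [c t] for [t] in the infimum. The reverse inequality is the same statement for
   [c^-1]. *)
have g'Z_le c h : 0 < c -> TT h -> g' (c *: h) <= c * g' h.
  move=> c0 Th; rewrite -ler_pdivrMl//; apply: le_g' => t t0.
  rewrite ler_pdivrMl//; have ct0 : 0 <= c * t by rewrite mulr_ge0// ltW.
  apply: le_trans (g'_le _ _ (TTZ c Th) ct0) _.
  rewrite -scalerA -scalerDr (gZ _ _ (ltW c0)); last exact: TTD (TTZ _ _).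
  by rewrite mulrBr mulrA.
have subg' : sublinear_on TT g'.
  split=> [c h|h k Th Tk].
    rewrite le_eqVlt => /predU1P[<- Th|c0 Th].
      rewrite scale0r mul0r; apply: le_anti; apply/andP; split.
        by rewrite -[leRHS]sublinear0 g'_g.
      by apply: le_g' => t t0; rewrite add0r gZ// subrr.
    apply: le_anti; rewrite g'Z_le//=.
    have ci0 : 0 < c^-1 by rewrite invr_gt0.
    have := g'Z_le _ _ ci0 (TTZ c Th).
    by rewrite scalerA mulVf ?gt_eqF// scale1r ler_pdivlMl.
  (* Parameters [s] for [h] and [t] for [k] provide the competitor [s + t] for [h + k]. *)
  rewrite -lerBlDr; apply: (le_g') => s s0; rewrite lerBlDr -lerBlDl.
  apply: le_g' => t t0; rewrite lerBlDl.
  apply: le_trans (g'_le _ (s + t) (TTD Th Tk) (addr_ge0 s0 t0)) _.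
  have := gD _ _ (TTD Th (TTZ s Th0)) (TTD Tk (TTZ t Th0)).
  by rewrite addrACA -scalerDl; lra.
have g'C h : TT h -> g' h <= C * `|h|.
  by move=> Th; apply: le_trans (g'_g h Th) (gC Th).
have [l [Tl lg]] := subgradient_exists linT subg' C0 g'C.
exists l; first by split => // h Th; apply: le_trans (lg h Th) (g'_g h Th).
apply: le_anti; rewrite (le_trans (lg _ Th0) (g'_g _ Th0))/=.
(* At [t = 1] the competitor for [- h0] is [g 0 - g h0 = - g h0], whence [inner l h0 >= g h0]. *)
have := le_trans (lg _ (TTN Th0)) (g'_le _ 1 (TTN Th0) ler01).
by rewrite innerNr scale1r addNr sublinear0; lra.
Qed.

Lemma Lambda_nonempty : Lam !=set0.
Proof. by have [l Ll _] := Lambda_attained TT0; exists l. Qed.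

Lemma Lambda_convex : convex_set Lam.
Proof.
apply/convex_set_lmodP => t x y /andP[t0 t1] [Tx xg] [Ty yg]; split.
  apply: (linear_subspaceD (closure_linear_subspace linT));
    exact: (linear_subspaceZ (closure_linear_subspace linT)).
move=> h Th; rewrite innerDl !innerZl.
have := ler_wpM2l t0 (xg h Th).
have t1' : 0 <= 1 - t by rewrite subr_ge0.
by have := ler_wpM2l t1' (yg h Th); lra.
Qed.

Lemma Lambda_closed : closed Lam.
Proof.
move=> x Lx; split.
  have := closure_subset (B := closure TT) (fun l (Ll : Lam l) => Ll.1) Lx.
  by rewrite -(proj1 (closure_id _) (@closed_closure _ _)).
move=> h Th; rewrite innerC.
apply: (@closure_le _ _ (inner h) Lam (g h) (@inner_continuous _ _ _ _ h)) => //.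
by move=> l [_ lg]; rewrite innerC lg.
Qed.

(** Testing [l] against itself gives [|l|^2 <= C |l|]. As [l] is only in the closure of [TT], the
    inequality [inner l h <= C |h|] is first extended there by continuity. *)
Lemma Lambda_norm_le l : Lam l -> `|l| <= C.
Proof.
move=> [Tl lg]; have [->|l0] := eqVneq l 0; first by rewrite normr0.
have nl : 0 < `|l| :> R by rewrite normr_gt0.
pose f h : R := inner l h - C * `|h|.
have cf : continuous f.
  apply: (@lipschitz_continuous _ _ _ (`|l| + C)) => x y.
  have -> : f x - f y = inner l (x - y) - C * (`|x| - `|y|).
    by rewrite /f innerBr; ring.
  apply: le_trans (ler_normB _ _) _; rewrite mulrDl lerD ?normr_inner_le//.
  by rewrite normrM ger0_norm// ler_wpM2l// ler_dist_dist.
have := @closure_le _ _ f TT 0 cf _ l Tl.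
rewrite /f inner_normr -mulrBl pmulr_lle0// subr_le0; apply => h Th.
by rewrite subr_le0; apply: le_trans (lg h Th) (gC Th).
Qed.

Lemma Lambda_max h : TT h -> maximum_of [set inner l h | l in Lam] (g h).
Proof.
move=> Th; split; first by have [l Ll lh] := Lambda_attained Th; exists l.
by move=> _ [l [_ lg] <-]; exact: lg.
Qed.

(** If [g (- h) = - g h], the bounds at [h] and [- h] squeeze [inner l h]. Conversely, evaluate an
    element of [Lam] that attains [g (- h)]. *)
Lemma NspaceP h : N h <-> TT h /\ forall l, Lam l -> inner l h = g h.
Proof.
split=> [[Th gN]|[Th lgh]]; split => //.
  move=> l [_ lg]; apply: le_anti; rewrite lg//=.
  by have := lg _ (TTN Th); rewrite innerNr; lra.
have [l Ll lN] := Lambda_attained (TTN Th).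
by rewrite -lN innerNr lgh// subrr.
Qed.

(** Some [l] in [Lam] attains [g] at [a u + v], and the same [l] computes [g] at [u] and at [v]. *)
Lemma Nspace_linear_on : linear_on N g.
Proof.
move=> a u v /NspaceP[Tu ug] /NspaceP[Tv vg].
have [l Ll <-] := Lambda_attained (TTD (TTZ a Tu) Tv).
by rewrite innerDr innerZr ug// vg.
Qed.

Lemma Nspace_subspace : linear_subspace N.
Proof.
apply: linear_subspaceI.
  by apply/NspaceP; split=> // l _; rewrite inner0r sublinear0.
move=> a u v Nu Nv; have := Nspace_linear_on a Nu Nv.
move: Nu Nv => /NspaceP[Tu ug] /NspaceP[Tv vg] guv.
apply/NspaceP; split; first exact: TTD (TTZ _ _) _.
by move=> l Ll; rewrite guv innerDr innerZr ug// vg.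
Qed.

Lemma Nspace_core : N = core_space TT g.
Proof.
apply/seteqP; split=> [w Nw|w []//]; split => // v c Nv.
by rewrite addrC Nspace_linear_on// addrC.
Qed.

(** For [w] in [N], apply subadditivity to [h = (h + w) - w]; for the converse, take [h = - w]. *)
Lemma Nspace_additivity : N = additivity_space TT g.
Proof.
apply/seteqP; split=> w.
  move=> [Tw gw]; split => // h Th; apply: le_anti; rewrite subg.2//=.
  have := subg.2 _ _ (TTD Th Tw) (TTN Tw); rewrite addrK; lra.
by move=> [Tw wg]; split => //; rewrite addrC -wg ?addNr ?sublinear0//; exact: TTN.
Qed.

(** Orthogonality to the differences means that all of [Lam] agrees at [h], and one element of [Lam]
    attains [g h]. *)
Lemma Nspace_orth : N = orth_compl F `&` TT.
Proof.
apply/seteqP; split=> h.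
  move=> /NspaceP[Th lh]; split => // f Ff.
  apply: (orth_closure_span _ Ff) => _ [l Ll [l' Ll' <-]].
  by rewrite innerBl !lh// subrr.
move=> [Fh Th]; apply/NspaceP; split => // l Ll.
have [l' Ll' <-] := Lambda_attained Th.
apply/eqP; rewrite -subr_eq0 -innerBl; apply/eqP/Fh.
by apply: subset_closure; apply: sub_linear_span; exists l => //; exists l'.
Qed.

(** Linearity forces [g (- h) = - g h]. Hence [N] is the largest linearity subspace, and so the only
    maximal one. *)
Lemma linearity_sub_Nspace (V : set L2) : linearity_subspaces TT g V -> V `<=` N.
Proof.
move=> [linV VT ling] h Vh; split; first exact: VT.
have V0 := linear_subspace0 linV.
have := ling (-1) _ _ Vh V0; rewrite addr0 scaleN1r sublinear0 => ->.
by lra.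
Qed.

Lemma Nspace_linearity : linearity_subspaces TT g N.
Proof.
split; [exact: Nspace_subspace|by move=> h []|exact: Nspace_linear_on].
Qed.

Lemma max_linearity_Nspace : max_linearity_subspaces TT g = [set N].
Proof.
apply/seteqP; split=> V.
  move=> [LV maxV]; rewrite /= (maxV N) //; first exact: Nspace_linearity.
  exact: linearity_sub_Nspace.
move=> ->; split; first exact: Nspace_linearity.
by move=> W LW NW; apply/seteqP; split => //; exact: linearity_sub_Nspace.
Qed.

Lemma representer_exists (V : set L2) : linearity_subspaces TT g V ->
  closure V (riesz_representer V g) /\
  forall h, V h -> inner (riesz_representer V g) h = g h.
Proof.
move=> [linV VT ling].
have [p Vp pg] := riesz_exists linV ling C0 (fun h Vh => gC (VT h Vh)).
by rewrite (riesz_representerE linV Vp pg).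
Qed.

(** Every [l] in [Lam] restricts to [g] on [N], so the representer and the projection solve the same
    equations. *)
Lemma representer_orth_proj l : Lam l -> riesz_representer N g = orth_proj N l.
Proof.
move=> Ll; have [Np pg] := representer_exists Nspace_linearity.
apply/esym/orth_projE => //; first exact: Nspace_subspace.
by move=> h Nh; rewrite pg//; move/NspaceP : Nh => [_ ->].
Qed.

End lambda.

(** * Closed tangent space *)

Section closed_tangent_space.
Context {d : measure_display} {Omega : measurableType d} {R : realType}.
Context {P : probability Omega R}.
Local Notation L2 := (LspaceType2 P).
Implicit Types (x y z h l w : L2).
Context {TT : set L2} {g : L2 -> R} {C : R}.
Hypotheses (linT : linear_subspace TT) (subg : sublinear_on TT g).
Hypotheses (C0 : 0 <= C) (gC : forall h, TT h -> g h <= C * `|h|).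
Hypothesis clT : closed TT.
Local Notation Lam := (Lambda_set TT g).
Local Notation F := (Fspace TT g).
Local Notation N := (Nspace TT g).
Local Notation psi := (riesz_representer N g).
Local Notation affL := (closure (affine_hull Lam)).

Let closureTT : closure TT = TT.
Proof. by rewrite -(proj1 (closure_id _) clT). Qed.

Let linN : linear_subspace N := Nspace_subspace linT subg C0 gC.

Let NE h : N h <-> orth_compl F h /\ TT h.
Proof. by rewrite (Nspace_orth linT subg C0 gC). Qed.

Lemma Fspace_subspace : linear_subspace F.
Proof. exact/closure_linear_subspace/linear_span_subspace. Qed.

Lemma Fspace_sub : F `<=` TT.
Proof.
rewrite -[X in _ `<=` X]closureTT; apply: closure_subset.
apply: linear_span_sub => // _ [l [Tl _] [l' [Tl' _] <-]].
by apply: (linear_subspaceB linT); rewrite -closureTT.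
Qed.

Lemma Nspace_Fspace_orth a f : N a -> F f -> inner a f = 0.
Proof. by move=> /NE[Fa _] Ff; rewrite innerC Fa. Qed.

(** Project [h] onto [F]. The residual stays in [TT], which contains [F], and is orthogonal to [F],
    so it lies in [N]. *)
Lemma tangent_decomposition h : TT h ->
  exists a f, [/\ N a, F f & h = a + f].
Proof.
move=> Th; have [f Ff fh] := orth_proj_exists h Fspace_subspace.
have {}Ff : F f by rewrite /Fspace (proj1 (closure_id _) (@closed_closure _ _)).
exists (h - f), f; split => //; last by rewrite subrK.
apply/NE; split; last exact: (linear_subspaceB linT Th (Fspace_sub Ff)).
by move=> k Fk; rewrite innerC innerBl fh// subrr.
Qed.

Lemma tangent_orthogonal_sum : orthogonal_sum TT N F.
Proof.
split.
- apply/seteqP; split=> h.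
    by move=> /tangent_decomposition[a [f [Na Ff ->]]]; exists a => //; exists f.
  move=> [a [Ta _] [f Ff <-]].
  exact: (linear_subspaceD linT Ta (Fspace_sub Ff)).
- apply/seteqP; split=> h.
    by move=> [Nh Fh]; apply: inner_eq0; exact: Nspace_Fspace_orth.
  move=> ->; split; [exact: linear_subspace0|].
  exact: (linear_subspace0 Fspace_subspace).
- exact: Nspace_Fspace_orth.
Qed.

Let psiP := representer_exists C0 gC (Nspace_linearity linT subg C0 gC).

(** A priori [psi] is only in the closure of [N]; both orthogonality to [F] and membership in the
    closed set [TT] survive the limit. *)
Lemma representer_mem : N psi.
Proof.
have [Npsi _] := psiP; apply/NE; split.
  move=> f Ff; move: Npsi; apply: inner_closure0 => a Na.
  by rewrite innerC (Nspace_Fspace_orth Na).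
have : closure TT psi by apply: closure_subset Npsi => a [].
by rewrite closureTT.
Qed.

(** The [N]-component of [l] also represents [g] on [N], so by uniqueness it is [psi]. *)
Lemma Lambda_sub_representer l : Lam l -> F (l - psi).
Proof.
move=> Ll; have Tl : TT l by rewrite -closureTT; exact: Ll.1.
have [a [f [Na Ff lE]]] := tangent_decomposition Tl.
suff <- : a = psi by rewrite lE addrAC subrr add0r.
apply: (closure_inner_inj linN); [exact: subset_closure|exact: psiP.1|].
move=> h Nh; rewrite psiP.2//.
rewrite -((proj1 (NspaceP linT subg C0 gC h) Nh).2 l Ll).
by rewrite lE innerDl [inner f h]innerC (Nspace_Fspace_orth Nh Ff) addr0.
Qed.

Let clF f : closure F f -> F f.
Proof.
rewrite [X in X f -> _](_ : _ = F)//.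
by rewrite -(proj1 (closure_id _) (@closed_closure _ _)).
Qed.

(** For one inclusion, [l + F] is a closed affine set containing [Lam]. *)
Lemma affine_hull_Lambda l : Lam l -> affL = [set l + f | f in F].
Proof.
move=> Ll; have linF := Fspace_subspace.
have FL l1 l2 : Lam l1 -> Lam l2 -> F (l1 - l2).
  move=> L1 L2; apply: subset_closure; apply: sub_linear_span.
  by exists l1 => //; exists l2.
apply/seteqP; split=> x.
  move=> affx; exists (- l + x); last by rewrite addrC addrAC addNr add0r.
  apply: clF; apply: (@closure_translation _ _ F (- l) x).
  apply: closure_subset affx => y; apply; split => [t u v /= Fu Fv|l' Ll' /=].
    have -> : - l + (t *: u + (1 - t) *: v) =
              t *: (- l + u) + ((1 - t) *: (- l + v)).
      by rewrite !scalerDr addrACA -scalerDl [t + _]addrC subrK scale1r.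
    apply: (linear_subspaceD linF); exact: (linear_subspaceZ linF).
  by rewrite addrC; exact: FL.
move=> [f Ff <-].
(* For the other inclusion: the directions of the closed affine hull at [l] form a closed subspace,
   which contains every [l1 - l2 = (l1 - l) - (l2 - l)] and therefore [F]. *)
pose G := [set y | affL (l + y)].
have affLl l' : Lam l' -> affL l'.
  by move=> Ll'; apply: subset_closure; exact: sub_affine_hull.
have linG : linear_subspace G.
  apply: affine_direction (affLl _ Ll).
  by apply: closure_affine; exact: affine_hull_affine.
suff : closure G f.
  move=> /closure_translation.
  by rewrite -(proj1 (closure_id _) (@closed_closure _ _)).
apply: closure_subset Ff; apply: linear_span_sub => // _ [l1 L1 [l2 L2 <-]].
have -> : l1 - l2 = (l1 - l) - (l2 - l) by rewrite opprB addrA subrK.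
by apply: (linear_subspaceB linG); rewrite /G/= addrC subrK; exact: affLl.
Qed.

(** Moves the base point to [psi], which need not belong to [Lam] but differs from its elements by
    members of [F]. *)
Lemma affine_hull_representer : affL = [set psi + f | f in F].
Proof.
have [l Ll] := Lambda_nonempty linT subg C0 gC.
have Fl := Lambda_sub_representer Ll.
rewrite (affine_hull_Lambda Ll); apply/seteqP; split=> _ [f Ff <-].
  exists (l - psi + f); first exact: (linear_subspaceD Fspace_subspace).
  by rewrite addrA [psi + _]addrC subrK.
exists (f - (l - psi)); first exact: (linear_subspaceB Fspace_subspace).
by rewrite [LHS]addrC opprB -addrA subrK addrC.
Qed.

Lemma representer_pythagoras f : F f ->
  inner (psi + f) (psi + f) = inner psi psi + inner f f.
Proof.
by move=> Ff; rewrite innerD_sqr (Nspace_Fspace_orth representer_mem Ff) mulr0 addr0.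
Qed.

Lemma representer_affine : affL psi.
Proof.
rewrite affine_hull_representer; exists 0; last by rewrite addr0.
exact: (linear_subspace0 Fspace_subspace).
Qed.

Lemma representer_norm_le x : affL x -> `|psi| <= `|x|.
Proof.
rewrite affine_hull_representer => -[f Ff <-].
rewrite normr_le_inner// normr_inner representer_pythagoras//.
by rewrite lerDl inner_ge0.
Qed.

(** By Pythagoras a competitor [psi + f] exceeds [psi] in squared norm by [|f|^2]. *)
Lemma affine_hull_min_norm :
  [set x | affL x /\ forall y, affL y -> `|x| <= `|y|] = [set psi].
Proof.
apply/seteqP; split=> x; last first.
  by move=> ->; split; [exact: representer_affine|exact: representer_norm_le].
move=> [affx /(_ _ representer_affine)]; move: affx.
rewrite affine_hull_representer => -[f Ff <-].
rewrite normr_le_inner// normr_inner representer_pythagoras//.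
rewrite gerDl => f0; suff -> : f = 0 by rewrite addr0.
by apply: inner_eq0; apply: le_anti; rewrite f0 inner_ge0.
Qed.

Lemma affine_hull_orth : affL `&` orth_compl F = [set psi].
Proof.
apply/seteqP; split=> x; last first.
  move=> ->; split; first exact: representer_affine.
  by have /NE[] := representer_mem.
rewrite affine_hull_representer => -[[f Ff <-]] /(_ f Ff).
rewrite innerDr innerC (Nspace_Fspace_orth representer_mem Ff) add0r.
by move=> /inner_eq0 ->; rewrite addr0.
Qed.

Lemma sqnorm_rieszE (V : set L2) :
  sqnorm_riesz V g = inner (riesz_representer V g) (riesz_representer V g).
Proof. by rewrite -normr_inner. Qed.

Lemma sqnorm_riesz_Vstar : ((sqnorm_riesz N g)%:E = Vstar TT g)%E.
Proof.
apply/eqP; rewrite eq_le; apply/andP; split.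
  by apply: ereal_sup_ubound; exists N => //; exact: Nspace_linearity linT subg C0 gC.
apply: ge_ereal_sup => _ [V LV <-]; rewrite lee_fin !sqnorm_rieszE.
have VN := linearity_sub_Nspace linT subg LV.
have [Vpsi Vg] := representer_exists C0 gC LV.
set p := riesz_representer V g in Vpsi Vg *.
(* Both vectors represent [g] on [V], so [p] is the projection of [psi] onto its closure, and
   [|psi|^2 - |p|^2 = |p - psi|^2]. *)
have : inner (p - psi) p = 0.
  move: Vpsi; apply: inner_closure0 => h Vh.
  by rewrite innerBl Vg// psiP.2 ?subrr//; exact: VN.
rewrite innerBl => pp; have := inner_ge0 (p - psi).
by rewrite innerB_sqr innerC; have := innerC psi p; lra.
Qed.

Lemma sqnorm_riesz_dist : sqnorm_riesz N g = dist_to_set 0 affL ^+ 2.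
Proof.
rewrite /sqnorm_riesz; congr (_ ^+ 2); apply: le_anti; apply/andP; split.
  apply: lb_le_inf; first by exists `|0 - psi|, psi => //; exact: representer_affine.
  by move=> _ [x affx <-]; rewrite sub0r normrN representer_norm_le.
apply: ge_inf; first by exists 0 => _ [x _ <-]; exact: normr_ge0.
by exists psi; [exact: representer_affine|rewrite sub0r normrN].
Qed.

(** The excess of [|l|^2] is [|l - psi|^2]. It vanishes exactly when [l = psi], and [psi] is the
    point of [psi + F] orthogonal to [F]. *)
Lemma sqnorm_riesz_Lambda l : Lam l ->
  sqnorm_riesz N g <= `|l| ^+ 2 /\
  (sqnorm_riesz N g = `|l| ^+ 2 <-> orth_compl F l).
Proof.
move=> Ll; have Fl := Lambda_sub_representer Ll.
have lE : l = psi + (l - psi) by rewrite addrC subrK.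
have le2 : inner l l = inner psi psi + inner (l - psi) (l - psi).
  by rewrite [in LHS]lE representer_pythagoras.
rewrite sqnorm_rieszE normr_inner le2; split; first by rewrite lerDl inner_ge0.
split=> [/eqP|Fol].
  rewrite eq_sym -subr_eq0 addrC addKr => /eqP/inner_eq0/eqP.
  rewrite subr_eq0 => /eqP ->.
  by have /NE[] := representer_mem.
have := Fol _ Fl; rewrite [in X in inner _ X]lE innerDr innerC.
by rewrite (Nspace_Fspace_orth representer_mem Fl) add0r => ->; rewrite addr0.
Qed.

End closed_tangent_space.

(** * Finite-dimensional linear algebra *)

Section moore_penrose_existence.
Context {R : realType}.

(** If [v A A^T = 0], then [v A] has vanishing sum of squares, so [v A = 0] and [v = 0]. *)
Lemma row_free_mul_tr {m n : nat} (A : 'M[R]_(m, n)) :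
  row_free A -> A *m A^T \in unitmx.
Proof.
move=> freeA; rewrite -row_free_unit; apply: inj_row_free => v vA0.
apply: (row_free_inj freeA); rewrite mul0mx.
have : (v *m A *m (v *m A)^T) 0 0 = 0.
  by rewrite trmx_mul mulmxA -(mulmxA v) vA0 mul0mx mxE.
rewrite mxE => /eqP; rewrite psumr_eq0 => [/allP sq0|j _]; last first.
  by rewrite [X in _ * X]mxE -expr2 sqr_ge0.
apply/rowP => j; have := sq0 j (mem_index_enum j).
by rewrite [X in _ * X]mxE -expr2 sqrf_eq0 => /eqP->; rewrite mxE.
Qed.

(** The full-rank factorisation formula. The two products with [B D] are the orthogonal projections
    onto the column space of [B] and the row space of [D], whence their symmetry. *)
Lemma moore_penrose_factor {m r n : nat} (B : 'M[R]_(m, r)) (D : 'M[R]_(r, n)) :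
  B^T *m B \in unitmx -> D *m D^T \in unitmx ->
  is_moore_penrose (B *m D)
    (D^T *m invmx (D *m D^T) *m (invmx (B^T *m B) *m B^T)).
Proof.
move=> uB uD.
have symD : (invmx (D *m D^T))^T = invmx (D *m D^T).
  by rewrite trmx_inv trmx_mul trmxK.
have symB : (invmx (B^T *m B))^T = invmx (B^T *m B).
  by rewrite trmx_inv trmx_mul trmxK.
set X := D^T *m _ *m _.
have AX : B *m D *m X = B *m invmx (B^T *m B) *m B^T.
  by rewrite /X !mulmxA -(mulmxA B D) mulmxK.
have XA : X *m (B *m D) = D^T *m invmx (D *m D^T) *m D.
  by rewrite /X !mulmxA -(mulmxA _ B^T B) mulmxKV.
split.
- by rewrite AX !mulmxA -(mulmxA _ B^T B) mulmxKV.
- by rewrite XA /X !mulmxA -(mulmxA _ D D^T) mulmxKV.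
- by rewrite AX !trmx_mul trmxK symB mulmxA.
- by rewrite XA !trmx_mul trmxK symD mulmxA.
Qed.

(** [col_base] and [row_base] form a full-rank factorisation, so the default of [xget] is never
    taken. *)
Lemma moore_penroseP {m n : nat} (A : 'M[R]_(m, n)) :
  is_moore_penrose A (moore_penrose A).
Proof.
have uD : row_base A *m (row_base A)^T \in unitmx.
  by apply: row_free_mul_tr; exact: row_base_free.
have uB : (col_base A)^T *m col_base A \in unitmx.
  rewrite -[X in _ *m X]trmxK; apply: row_free_mul_tr.
  by rewrite /row_free mxrank_tr; exact: col_base_full.
have := moore_penrose_factor uB uD; rewrite mulmx_base => AX.
by apply: xgetPex; eexists; exact: AX.
Qed.

(** The Fredholm alternative. If [b^T] is outside the row space, some column of [cokermx A] pairs
    nontrivially with [b]; it is rescaled to pair to 1. *)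
Lemma range_or_kernel {n : nat} (A : 'M[R]_n) (b : 'cV[R]_n) : A^T = A ->
  (exists x, A *m x = b) \/ exists u : 'cV[R]_n, A *m u = 0 /\ (b^T *m u) 0 0 = 1.
Proof.
move=> symA; have [/submxP[D bD]|] := boolP (b^T <= A)%MS.
  by left; exists D^T; rewrite -[A]symA -trmx_mul -bD trmxK.
rewrite submxE => /rV0Pn[j bj]; right.
pose c := (b^T *m cokermx A) 0 j.
exists (c^-1 *: (cokermx A *m delta_mx j 0)); split.
  by rewrite -scalemxAr mulmxA mulmx_coker mul0mx scaler0.
by rewrite -scalemxAr mulmxA -colE mxE [X in _ * X]mxE mulVf.
Qed.

End moore_penrose_existence.

(** * Finite families: combinations, bases and convex hulls *)

Section finite_families.
Context {R : realType} {V : lmodType R}.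

Definition linear_comb {n : nat} (e : 'I_n -> V) (w : 'cV[R]_n) : V :=
  \sum_i w i 0 *: e i.

Lemma linear_combZ {n : nat} (e : 'I_n -> V) a w :
  linear_comb e (a *: w) = a *: linear_comb e w.
Proof. by rewrite scaler_sumr; apply: eq_bigr => i _; rewrite mxE scalerA. Qed.

Lemma linear_span_range {n : nat} (e : 'I_n -> V) :
  linear_span (range e) = range (linear_comb e).
Proof.
apply/seteqP; split.
  apply: linear_span_sub.
    apply: linear_subspaceI.
      exists 0 => //; rewrite /linear_comb big1// => i _.
      by rewrite mxE scale0r.
    move=> a _ _ [u _ <-] [v _ <-]; exists (a *: u + v) => //.
    rewrite -linear_combZ /linear_comb -big_split/=.
    by apply: eq_bigr => i _; rewrite mxE scalerDl.
  move=> _ [i _ <-]; exists (delta_mx i 0) => //.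
  rewrite /linear_comb (bigD1 i)//= big1 => [|j ji].
    by rewrite mxE !eqxx scale1r addr0.
  by rewrite mxE (negbTE ji) scale0r.
move=> _ [w _ <-]; apply: (linear_subspace_sum (linear_span_subspace _)) => i.
by apply: sub_linear_span; exists i.
Qed.

(** This is the independence clause of [codim_is] at [[set 0]], so that a basis directly witnesses
    [dim_is]. *)
Definition linear_indep {n : nat} (e : 'I_n -> V) : Prop :=
  forall c : 'I_n -> R, \sum_i c i *: e i = 0 -> forall i, c i = 0.

(** Induction on [n]: the first vector is kept only if it lies outside the span of the basis
    extracted from the others. *)
Lemma extract_basis {n : nat} (v : 'I_n -> V) : exists r (e : 'I_r -> V),
  [/\ (r <= n)%N, range e `<=` range v, linear_indep e &
      range v `<=` linear_span (range e)].
Proof.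
elim: n v => [v|n IH v].
  exists 0%N, v; split => // [c _ []//|x].
  exact: sub_linear_span.
have [r [e [rn ev inde ve]]] := IH (fun i => v (lift ord0 i)).
have ev' : range e `<=` range v.
  by move=> x /ev[i _ <-]; exists (lift ord0 i).
have vE x : range v x -> x = v ord0 \/ linear_span (range e) x.
  move=> [i _ <-]; case: (unliftP ord0 i) => [j ->|->]; last by left.
  by right; apply: ve; exists j.
have [spv|nspv] := pselect (linear_span (range e) (v ord0)).
  exists r, e; split => //; first exact: leqW.
  by move=> x /vE[->|].
exists r.+1, (fun i => if unlift ord0 i is Some j then e j else v ord0).
split => //.
- move=> _ [i _ <-]; case: unliftP => [j _|_]; last by exists ord0.
  by apply: ev'; exists j.
- move=> c; rewrite big_ord_recl unlift_none.
  under eq_bigr => j _ do rewrite liftK.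
  move=> c0; have [c00|c00] := eqVneq (c ord0) 0.
    move=> i; case: (unliftP ord0 i) => [j ->|->//].
    by apply: (inde (fun j => c (lift ord0 j))); rewrite -[RHS]c0 c00 scale0r add0r.
  (* A nonzero coefficient allows solving for [v ord0] in terms of [e]. *)
  exfalso; apply: nspv; have linE := linear_span_subspace (range e).
  rewrite -[v ord0]scale1r -(mulVf c00) -scalerA.
  apply: (linear_subspaceZ linE); move/eqP: c0; rewrite addr_eq0 => /eqP ->.
  apply: (linear_subspaceN linE); apply: (linear_subspace_sum linE) => j.
  by apply: sub_linear_span; exists j.
- move=> x /vE[->|].
    by apply: sub_linear_span; exists ord0 => //; rewrite unlift_none.
  apply: linear_span_sub; first exact: linear_span_subspace.
  move=> _ [j _ <-]; apply: sub_linear_span; exists (lift ord0 j) => //.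
  by rewrite liftK.
Qed.

Lemma conv_hull_sub (A B : set V) :
  convex_set (B : set (convex_lmodType V)) -> A `<=` B -> conv_hull A `<=` B.
Proof. by move=> cB AB x; apply. Qed.

Lemma sub_conv_hull (A : set V) : A `<=` conv_hull A.
Proof. by move=> x Ax B [_]; apply. Qed.

End finite_families.

(** * Gram matrices *)

Section gram.
Context {d : measure_display} {Omega : measurableType d} {R : realType}.
Context {P : probability Omega R}.
Local Notation L2 := (LspaceType2 P).
Context {n : nat}.
Implicit Types (v : 'I_n -> L2) (w : 'cV[R]_n).

Definition gram v : 'M[R]_n := \matrix_(a, b) inner (v a) (v b).

Lemma tr_gram v : (gram v)^T = gram v.
Proof. by apply/matrixP => i j; rewrite !mxE innerC. Qed.

Lemma inner_linear_comb v w i : inner (v i) (linear_comb v w) = (gram v *m w) i 0.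
Proof.
rewrite mxE inner_sumr; apply: eq_bigr => j _.
by rewrite mxE innerZr mulrC.
Qed.

Lemma quad_form_gram v w :
  quad_form (gram v) w = inner (linear_comb v w) (linear_comb v w).
Proof.
rewrite /quad_form -mulmxA mxE inner_suml; apply: eq_bigr => j _.
by rewrite mxE innerZl inner_linear_comb.
Qed.

(** The quadratic form of the Gram matrix is a squared norm, so its kernel consists of linear
    relations. *)
Lemma linear_comb_eq0 v w : gram v *m w = 0 -> linear_comb v w = 0.
Proof.
move=> vw0; apply: inner_eq0.
by rewrite -quad_form_gram /quad_form -mulmxA vw0 mulmx0 mxE.
Qed.

Lemma gram_unitmx v : linear_indep v -> gram v \in unitmx.
Proof.
move=> indv; rewrite -unitmx_tr -row_free_unit; apply: inj_row_free => w w0.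
have {w0} : gram v *m w^T = 0 by rewrite -[gram v]trmxK -trmx_mul w0 trmx0.
move=> /linear_comb_eq0 /indv w0; apply/rowP => j.
by have := w0 j; rewrite !mxE.
Qed.

Lemma pos_semidef_gram v : pos_semidef (gram v).
Proof. by split; [exact: tr_gram|move=> w; rewrite quad_form_gram inner_ge0]. Qed.

Lemma inner_conv_hull v y (c : R) : (forall i, inner (v i) y = c) ->
  forall x, conv_hull (range v) x -> inner x y = c.
Proof.
move=> vc; apply: (@conv_hull_sub _ _ _ [set x | inner x y = c]); last first.
  by move=> _ [i _ <-]; exact: vc.
apply/convex_set_lmodP => t u z _ /= uc zc.
by rewrite innerDl !innerZl uc zc; ring.
Qed.

(** The coefficients solve the normal equations. This places the projection in the span itself, as
    [codim_is] demands, and not merely in its closure. *)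
Lemma orth_complement_span v h : linear_indep v -> exists2 y,
  linear_span (range v) y & forall x, linear_span (range v) x -> inner x (h - y) = 0.
Proof.
move=> indv; have uG := gram_unitmx indv.
pose b : 'cV[R]_n := \col_i inner (v i) h.
exists (linear_comb v (invmx (gram v) *m b)); first by rewrite linear_span_range.
set y := linear_comb v _.
apply: (@linear_span_sub _ _ _ [set x | inner x (h - y) = 0]); last first.
  move=> _ [i _ <-] /=; rewrite innerBr inner_linear_comb mulmxA mulmxV// mul1mx.
  by rewrite mxE subrr.
apply: linear_subspaceI; first exact: inner0l.
by move=> a u z /= u0 z0; rewrite innerDl innerZl u0 z0 mulr0 addr0.
Qed.

End gram.

(** * Polytopes *)

Section polytope.
Context {d : measure_display} {Omega : measurableType d} {R : realType}.
Context {P : probability Omega R}.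
Local Notation L2 := (LspaceType2 P).
Implicit Types (x y z h l : L2).
Context {TT : set L2} {g : L2 -> R} {C : R}.
Hypotheses (linT : linear_subspace TT) (subg : sublinear_on TT g).
Hypotheses (C0 : 0 <= C) (gC : forall h, TT h -> g h <= C * `|h|).
Hypothesis clT : closed TT.
Local Notation Lam := (Lambda_set TT g).
Local Notation F := (Fspace TT g).
Local Notation N := (Nspace TT g).
Local Notation psi := (riesz_representer N g).
Local Notation affL := (closure (affine_hull Lam)).
Context {K : nat} {lam : 'I_K -> L2}.
Hypothesis LamE : Lam = conv_hull (range lam).
Implicit Types (w : 'cV[R]_K) (a : 'I_K).
Local Notation ones := (const_mx 1 : 'cV[R]_K).

Let Lam_lam a : Lam (lam a).
Proof. by rewrite LamE; apply: sub_conv_hull; exists a. Qed.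

Let F_lam a b : F (lam a - lam b).
Proof.
by apply: subset_closure; apply: sub_linear_span; exists (lam a) => //; exists (lam b).
Qed.

(** A value common to all vertices is taken on their whole convex hull, so differences within [Lam]
    pair to 0 with [h]. *)
Let orth_Fspace h (c : R) : (forall a, inner (lam a) h = c) -> orth_compl F h.
Proof.
move=> lamc f; apply: orth_closure_span => _ [l Ll [l' Ll' <-]].
move: Ll Ll'; rewrite LamE => Ll Ll'.
by rewrite innerBl !(inner_conv_hull lamc)// subrr.
Qed.

Lemma linear_comb_affine w : (ones^T *m w) 0 0 = 1 -> affL (linear_comb lam w).
Proof.
rewrite mxE; under eq_bigr do rewrite !mxE mul1r; move=> w1.
(* A base vertex exists, since an empty sum of weights could not be 1. Around it the combination is
   [lam a1] plus weighted differences, and negative weights are harmless. *)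
case: (pickP (xpredT : pred 'I_K)) => [a1 _|a0]; last first.
  move: w1; rewrite big1 => [|i _]; last by have := a0 i.
  by move=> /esym/eqP; rewrite oner_eq0.
have /seteqP[_] := affine_hull_Lambda (Lam_lam a1); apply.
exists (\sum_i w i 0 *: (lam i - lam a1)).
  by apply: (linear_subspace_sum (@Fspace_subspace _ _ _ _ TT g)) => i; exact: F_lam.
under eq_bigr do rewrite scalerBr.
by rewrite sumrB -scaler_suml w1 scale1r addrC subrK.
Qed.

(** Such a combination lies in the closed affine hull and pairs to [c] with every vertex, so it is
    orthogonal to [F]; only [psi] has both properties. *)
Lemma representer_linear_comb w (c : R) : (ones^T *m w) 0 0 = 1 ->
  gram lam *m w = const_mx c -> psi = linear_comb lam w.
Proof.
move=> w1 wc.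
have : (affL `&` orth_compl F) (linear_comb lam w).
  split; first exact: linear_comb_affine.
  by apply: (@orth_Fspace _ c) => a; rewrite inner_linear_comb wc mxE.
by rewrite (affine_hull_orth linT subg C0 gC clT) => ->.
Qed.

Local Notation in_range := (exists x : 'cV[R]_K, gram lam *m x = ones).
Local Notation Splus := (moore_penrose (gram lam)).
Local Notation denom := ((ones^T *m Splus *m ones) 0 0).
Local Notation wstar := (denom^-1 *: (Splus *m ones) : 'cV[R]_K).

(** The identity [S S^+ S = S] and [ones = S x] give [S S^+ ones = ones]. Hence [denom] is the
    squared norm of a vector whose inner product with each vertex is 1, and it is nonzero because
    there is a vertex. *)
Let wstarP : (0 < K)%N -> in_range ->
  [/\ denom != 0, gram lam *m wstar = const_mx denom^-1 &
      (ones^T *m wstar) 0 0 = 1].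
Proof.
move=> K0 [x xE].
have [SS _ _ _] := moore_penroseP (gram lam).
have S1 : gram lam *m (Splus *m ones) = ones.
  by rewrite -{1}xE !mulmxA SS xE.
have denomE : denom = inner (linear_comb lam (Splus *m ones))
                            (linear_comb lam (Splus *m ones)).
  have wS : (Splus *m ones)^T *m gram lam = ones^T.
    by have := congr1 trmx S1; rewrite trmx_mul tr_gram.
  by rewrite -quad_form_gram /quad_form wS mulmxA.
have d0 : denom != 0.
  apply/eqP; rewrite denomE => /inner_eq0 l0.
  have := inner_linear_comb lam (Splus *m ones) (Ordinal K0).
  by rewrite l0 inner0r S1 mxE => /esym/eqP; rewrite oner_eq0.
split => //.
  rewrite -scalemxAr S1; apply/matrixP => i j.
  by rewrite !mxE mulr1.
by rewrite -scalemxAr mulmxA mxE mulVf.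
Qed.

Lemma representer_in_range : (0 < K)%N -> in_range ->
  psi = linear_comb lam wstar.
Proof.
by move=> K0 /(wstarP K0)[_ ws w1]; exact: representer_linear_comb w1 ws.
Qed.

Lemma sqnorm_in_range : (0 < K)%N -> in_range -> sqnorm_riesz N g = 1 / denom.
Proof.
move=> K0 /(wstarP K0)[_ ws w1].
rewrite sqnorm_rieszE (representer_linear_comb w1 ws) -quad_form_gram.
rewrite div1r; set c := denom^-1 in ws w1 *; set w := c *: _ in ws w1 *.
rewrite /quad_form -mulmxA ws.
have -> : const_mx c = c *: ones :> 'cV[R]_K.
  by apply/matrixP => i j; rewrite !mxE mulr1.
rewrite -scalemxAr mxE.
have -> : w^T *m ones = (ones^T *m w)^T by rewrite trmx_mul trmxK.
by rewrite mxE w1 mulr1.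
Qed.

Let kernel_not_in_range : ~ in_range ->
  exists2 u : 'cV[R]_K, (ones^T *m u) 0 0 = 1 & gram lam *m u = 0.
Proof.
move=> nr; have [//|[u [Su u1]]] := range_or_kernel ones (tr_gram lam).
by exists u.
Qed.

(** A kernel vector with weights summing to 1 solves the normal equations with [c = 0], and its
    combination of the vertices is 0. *)
Lemma representer_not_in_range : ~ in_range -> psi = 0.
Proof.
move=> /kernel_not_in_range[u u1 Su].
rewrite (representer_linear_comb u1 (c := 0)) ?Su//.
exact: linear_comb_eq0.
Qed.

(** Admissible weights give points of the closed affine hull, with [quad_form] as squared norm. The
    minimiser is [wstar] or a kernel vector, according to the alternative. *)
Lemma sqnorm_minimum : (0 < K)%N ->
  minimum_of [set quad_form (gram lam) w | w in
    [set w : 'cV[R]_K | (ones^T *m w) 0 0 = 1]] (sqnorm_riesz N g).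
Proof.
move=> K0; split; last first.
  move=> _ [w /= w1 <-]; rewrite quad_form_gram -!normr_inner.
  rewrite ler_sqr ?nnegrE//.
  exact: (representer_norm_le linT subg C0 gC clT (linear_comb_affine w1)).
rewrite sqnorm_rieszE; have [[x xE]|[u [Su u1]]] := range_or_kernel ones (tr_gram lam).
  have [|_ ws w1] := wstarP K0; first by exists x.
  by exists wstar => //; rewrite quad_form_gram -(representer_linear_comb w1 ws).
by exists u => //; rewrite quad_form_gram (representer_linear_comb u1 (c := 0)).
Qed.

Lemma affine_hull0 : affL 0 <-> psi = 0.
Proof.
split=> [aff0|<-]; last exact: (representer_affine linT subg C0 gC clT).
have := representer_norm_le linT subg C0 gC clT aff0.
by rewrite normr0 normr_le0 => /eqP.
Qed.

Lemma sqnorm_eq0 : sqnorm_riesz N g = 0 <-> affL 0.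
Proof.
rewrite sqnorm_rieszE; split=> [/inner_eq0 psi0|/affine_hull0 ->].
  by apply/affine_hull0.
by rewrite inner0l.
Qed.

Lemma not_in_range_affine : (0 < K)%N -> ~ in_range <-> affL 0.
Proof.
move=> K0; split=> [/representer_not_in_range/affine_hull0//|aff0 r].
have := sqnorm_in_range K0 r; rewrite (proj2 sqnorm_eq0 aff0) div1r.
have [d0 _ _] := wstarP K0 r.
by move=> /esym/eqP; rewrite invr_eq0 (negbTE d0).
Qed.

(** A basis extracted from the differences [lam a - lam a1] is also a basis of [TT] modulo [N]. *)
Lemma codim_Nspace (a1 : 'I_K) : (forall a, TT (lam a)) -> exists r : nat,
  [/\ codim_is TT N r,
      dim_is (linear_span [set lam a - lam a1 | a in [set a | a != a1]]) r &
      (r <= K.-1)%N].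
Proof.
move=> Tlam.
pose v (i : 'I_K.-1) := lam (lift a1 i) - lam a1.
have vE : [set lam a - lam a1 | a in [set a | a != a1]] = range v.
  apply/seteqP; split=> x.
    move=> [a /= aa1 <-]; move: aa1; rewrite eq_sym => /unlift_some[i -> _].
    by exists i.
  by move=> [i _ <-]; exists (lift a1 i) => //=; rewrite eq_sym neq_lift.
have [r [e [rK ev inde ve]]] := extract_basis v.
have spanE : linear_span (range v) = linear_span (range e).
  apply/seteqP; split; apply: linear_span_sub; try exact: linear_span_subspace.
    exact: ve.
  by move=> x /ev vx; apply: sub_linear_span.
have linF : linear_subspace F := Fspace_subspace.
have Fv x : range v x -> F x by move=> [i _ <-]; exact: F_lam.
have Te i : TT (e i).
  have [j _ <-] : range v (e i) by apply: ev; exists i.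
  exact: linear_subspaceB.
exists r; split => //; rewrite ?vE.
- exists e; split => // [c Nc|].
    (* The combination lies in both [N] and [F], so it is orthogonal to itself. *)
    apply: inde; apply: inner_eq0.
    apply: (Nspace_Fspace_orth linT subg C0 gC Nc).
    apply: (linear_subspace_sum linF) => i.
    by apply: Fv; apply: ev; exists i.
  apply/seteqP; split=> h.
    move=> Th; have [y spy hy] := orth_complement_span h inde.
    exists (h - y); last by exists y => //; rewrite subrK.
    rewrite (Nspace_orth linT subg C0 gC); split.
      (* Being orthogonal to all differences from [lam a1], the residual [h - y] has the same inner
         product with every vertex. *)
      apply: (@orth_Fspace _ (inner (lam a1) (h - y))) => a.
      apply/eqP; rewrite -subr_eq0 -innerBl; apply/eqP.
      have [->|aa1] := eqVneq a a1; first by rewrite subrr inner0l.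
      apply: hy; rewrite -spanE -vE; apply: sub_linear_span.
      by exists a.
    apply: (linear_subspaceB linT Th).
    by apply: (linear_span_sub linT _ spy) => _ [i _ <-].
  move=> [x [Tx _] [y spy <-]]; apply: (linear_subspaceD linT Tx).
  by apply: (linear_span_sub linT _ spy) => _ [i _ <-].
- rewrite spanE; exists e; split => //.
    by move=> i; apply: sub_linear_span; exists i.
  apply/seteqP; split=> x; last by move=> [_ -> [y spy <-]]; rewrite add0r.
  by move=> spx; exists 0 => //; exists x => //; rewrite add0r.
Qed.

End polytope.

Theorem theorem3 (d : measure_display) (Omega : measurableType d)
    (R : realType) (PP : set (probability Omega R)) (P : probability Omega R)
    (PP_P : PP P) (TT : set (LspaceType2 P))
    (TT_sub : linear_subspace TT) (TT_L20 : TT `<=` L20 P)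
    (g : LspaceType2 P -> R)
    (g_sub : sublinear_on TT g) (g_cont : {within TT, continuous g}) :
  let Lam := Lambda_set TT g in
  let F := Fspace TT g in
  let Hk := core_space TT g in
  let psik := riesz_representer Hk g in
  let Vk := sqnorm_riesz Hk g in
  let affL := closure (affine_hull Lam) in
  [/\
    (* (1) *)
    [/\ Lam !=set0, convex_set Lam, closed Lam, bounded_set Lam &
        forall h, TT h -> maximum_of [set inner l h | l in Lam] (g h)],
    (* (2) *)
    [/\ Nspace TT g = Hk, Hk = additivity_space TT g,
        additivity_space TT g = orth_compl F `&` TT &
        max_linearity_subspaces TT g = [set Hk]],
    (* (3) *)
    [/\ forall h l, Hk h -> Lam l -> g h = inner l h,
        forall l, Lam l -> psik = orth_proj Hk l &
        assumption1 PP TT ->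
        [/\ orthogonal_sum TT Hk F,
            forall l, Lam l -> affL = [set l + f | f in F],
            [set x | affL x /\ forall y, affL y -> `|x| <= `|y|] = [set psik],
            affL `&` orth_compl F = [set psik] &
            (Vk%:E = Vstar TT g)%E /\ Vk = dist_to_set 0 affL ^+ 2]],
    (* (4) *)
    assumption1 PP TT ->
      forall l, Lam l -> Vk <= `|l| ^+ 2 /\ (Vk = `|l| ^+ 2 <-> orth_compl F l) &
    (* (5) *)
    assumption1 PP TT ->
      forall (K : nat) (K_gt0 : (0 < K)%N) (lam : 'I_K -> LspaceType2 P),
        (forall a, TT (lam a)) -> Lam = conv_hull (range lam) ->
        let Sigma := \matrix_(a, b) inner (lam a) (lam b) : 'M[R]_K in
        let ones := const_mx 1 : 'cV[R]_K in
        let in_range := exists x : 'cV[R]_K, Sigma *m x = ones in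
        let Splus := moore_penrose Sigma in
        let denom := (ones^T *m Splus *m ones) 0 0 in
        let wstar := denom^-1 *: (Splus *m ones) in
        let a1 := Ordinal K_gt0 in
        [/\ pos_semidef Sigma,
            minimum_of [set quad_form Sigma w | w in
                         [set w : 'cV[R]_K | (ones^T *m w) 0 0 = 1]] Vk,
            [/\ in_range -> Vk = 1 / denom, ~ in_range -> Vk = 0,
                Vk = 0 <-> affL 0 & ~ in_range <-> affL 0],
            in_range -> psik = \sum_a wstar a 0 *: lam a &
            exists r : nat,
              [/\ codim_is TT Hk r,
                  dim_is (linear_span [set lam a - lam a1 | a in [set a | a != a1]]) r &
                  (r <= K.-1)%N]]
  ].
Proof.
move=> Lam F Hk psik Vk affL.
have [C C0 gC] := continuous_sublinear_bound TT_sub g_sub g_cont.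
(* Once the core is replaced by [N], the lemmas on the representer of [g] on [N] apply verbatim. *)
have HkE : Hk = Nspace TT g by rewrite (Nspace_core TT_sub g_sub C0 gC).
rewrite /Vk /psik {psik Vk} HkE {HkE Hk}; split.
- split.
  + exact: Lambda_nonempty TT_sub g_sub C0 gC.
  + exact: Lambda_convex.
  + exact: Lambda_closed.
  + by apply: (@bounded_setI _ _ _ C) => l; exact: (Lambda_norm_le C0 gC).
  + exact: (Lambda_max TT_sub g_sub C0 gC).
- rewrite -(Nspace_additivity TT_sub g_sub); split => //.
  + exact: Nspace_orth TT_sub g_sub C0 gC.
  + exact: max_linearity_Nspace TT_sub g_sub C0 gC.
- split.
  + move=> h l /(proj1 (NspaceP TT_sub g_sub C0 gC h))[_ lh] Ll.
    by rewrite lh.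
  + exact: representer_orth_proj TT_sub g_sub C0 gC.
  + move=> [clT _]; split.
    * exact: tangent_orthogonal_sum TT_sub g_sub C0 gC clT.
    * exact: affine_hull_Lambda.
    * exact: affine_hull_min_norm TT_sub g_sub C0 gC clT.
    * exact: affine_hull_orth TT_sub g_sub C0 gC clT.
    * split; first exact: sqnorm_riesz_Vstar TT_sub g_sub C0 gC.
      exact: sqnorm_riesz_dist TT_sub g_sub C0 gC clT.
- by move=> [clT _]; exact: sqnorm_riesz_Lambda TT_sub g_sub C0 gC clT.
- move=> [clT _] K K0 lam Tlam LamE; split.
  + exact: pos_semidef_gram.
  + exact: (sqnorm_minimum TT_sub g_sub C0 gC clT LamE K0).
  + split.
    * exact: (sqnorm_in_range TT_sub g_sub C0 gC clT LamE K0).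
    * move=> /(representer_not_in_range TT_sub g_sub C0 gC clT LamE) psi0.
      by rewrite sqnorm_rieszE psi0 inner0l.
    * exact: (sqnorm_eq0 TT_sub g_sub C0 gC clT).
    * exact: (not_in_range_affine TT_sub g_sub C0 gC clT LamE K0).
  + exact: (representer_in_range TT_sub g_sub C0 gC clT LamE K0).
  + exact: (codim_Nspace TT_sub g_sub C0 gC LamE (Ordinal K0) Tlam).
Qed.
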